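(* Let $p=3$ and $F\in\mathscr F$. Let $K(F,6)$ denote the maximum $k$ such that the lexicographic code $\mathrm{Lex}_{F,6}(k)$ is a linear code ($\infty$ if it is linear for all $k$). Then $$K(F,6)=\begin{cases}6 & \text{if } F=F(\xi,9),\ 0\le \xi\le 8,\\ 3 & \text{if } F=F(\xi,\eta),\ 0\le\xi\le 8,\ \eta\ge 10\ (\eta\in\mathbb N),\\ 2 & \text{otherwise.}\end{cases}$$ In particular, if $F=F(\xi,9)$ and $0\le\xi\le 8$, then $\mathrm{Res}(\mathrm{Lex}_{F,6}(6))$ is the ternary Golay code.
   Context: $\mathbb N$ is the set of non-negative integers. $\mathbb F_p$ is identified with $\{0,1,\dots,p-1\}$, elements compared as integers (here $p=3$). $\mathbb F_p^{\mathbb N}$ is the space of finitely supported sequences $(x_i)_{i\in\mathbb N}$ over $\mathbb F_p$, with standard basis $E=(e_0,e_1,\dots)$. For distinct $\xi,\eta\in\mathbb N$, $F(\xi,\eta)=(f_i)_{i\in\mathbb N}$ is the ordered basis with $f_i=e_i$ for $i\ne\xi$ and $f_\xi=e_\xi+e_\eta$. Let $\mathscr F=\{E\}\cup\{F(\xi,\eta):\xi,\eta\in\mathbb N,\ \xi\neq\eta\}$. For an ordered basis $F=(f_i)$ write $x=\sum_i x_{[i]}f_i$; for $x\neq y$ let $N$ be the largest index with $x_{[N]}\ne y_{[N]}$ and set $x<_F y$ iff $x_{[N]}<y_{[N]}$. The Hamming distance is $d(x,y)=|\{i: x_i\neq y_i\}|$ in standard coordinates. For $d\ge2$, $w_{F,d}(a)$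 ($a\in\mathbb N$) is defined recursively as the $<_F$-minimum $z\in\mathbb F_p^{\mathbb N}$ with $d(z,w_{F,d}(b))\ge d$ for all $0\le b<a$, and $\mathrm{Lex}_{F,d}(k)=\{w_{F,d}(0),\dots,w_{F,d}(p^k-1)\}$. For a subset $L\subseteq\mathbb F_p^{\mathbb N}$, $\mathrm{Res}(L)$ is obtained from $L$ by deleting all standard coordinates $i$ at which every element of $L$ is zero. A code is linear if it is an $\mathbb F_p$-subspace. The ternary Golay code here is the (extended) $[12,6,6]$ code over $\mathbb F_3$, which is unique up to monomial equivalence. *)

(* Defs.v *)
From HB Require Import structures.
From mathcomp Require Import all_boot all_order all_algebra finmap.
From mathcomp Require Import all_classical.

Set Implicit Arguments.
Unset Strict Implicit.
Unset Printing Implicit Defensive.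

Import GRing.Theory.

Local Open Scope classical_set_scope.
Local Open Scope ring_scope.

(* The space of finitely supported sequences over 'F_p is {poly 'F_p}, used
   only as an 'F_p-vector space: x`_i is the i-th term of the sequence x and
   'X^i is the i-th standard basis vector. *)

Definition std_basis (p : nat) : nat -> {poly 'F_p} := fun i => 'X^i.

Definition mod_basis (p xi eta : nat) : nat -> {poly 'F_p} :=
  fun i => if i == xi then 'X^xi + 'X^eta else 'X^i.

Definition basis_family (p : nat) : set (nat -> {poly 'F_p}) :=
  [set F | F = std_basis p \/
           exists xi eta : nat, xi <> eta /\ F = mod_basis p xi eta].
Arguments basis_family : clear implicits.

Definition lincomb (p : nat) (F : nat -> {poly 'F_p}) (a : {poly 'F_p}) :
    {poly 'F_p} :=
  \sum_(i < size a) a`_i *: F i.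

(* a and b are the coordinate sequences of x and y in the basis F; the
   coordinates a`_N and b`_N are compared through the coercion of 'F_p to
   nat, with values 0, ..., p - 1. *)
Definition lt_basis (p : nat) (F : nat -> {poly 'F_p}) (x y : {poly 'F_p}) :
    Prop :=
  exists a b : {poly 'F_p},
    [/\ x = lincomb F a, y = lincomb F b &
        exists N : nat, ((a`_N)%R < (b`_N)%R)%N /\
          forall i : nat, (N < i)%N -> a`_i = b`_i].

(* Terms of index at least maxn (size x) (size y) vanish in both x and y. *)
Definition hdist (p : nat) (x y : {poly 'F_p}) : nat :=
  #|[pred i : 'I_(maxn (size x) (size y)) | x`_i != y`_i]|.

(* The default value 0 is only taken when A has no minimum, which does not
   happen for a nonempty A when F is in basis_family p. *)
Definition lexmin (p : nat) (F : nat -> {poly 'F_p}) (A : set {poly 'F_p}) :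
    {poly 'F_p} :=
  xget 0 [set z | A z /\ forall y, A y -> y <> z -> lt_basis F z y].

Definition lexnext (p : nat) (F : nat -> {poly 'F_p}) (d : nat)
    (s : seq {poly 'F_p}) : {poly 'F_p} :=
  lexmin F [set z | forall c, c \in s -> (d <= hdist z c)%N].

(* The list of the first a words w_{F,d}(0), ..., w_{F,d}(a - 1). *)
Fixpoint lexwords (p : nat) (F : nat -> {poly 'F_p}) (d a : nat) :
    seq {poly 'F_p} :=
  if a is b.+1 then rcons (lexwords F d b) (lexnext F d (lexwords F d b))
  else [::].

Definition lexword (p : nat) (F : nat -> {poly 'F_p}) (d a : nat) :
    {poly 'F_p} :=
  lexnext F d (lexwords F d a).

Definition Lex (p : nat) (F : nat -> {poly 'F_p}) (d k : nat) :
    set {poly 'F_p} :=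
  [set lexword F d a | a in [set a : nat | (a < p ^ k)%N]].

Definition is_linear_code (p : nat) (V : lmodType 'F_p) (C : set V) : Prop :=
  GRing.submod_closed [pred x | x \in C].

(* None stands for infinity. *)
Definition maxlin (p : nat) (F : nat -> {poly 'F_p}) (d : nat) : option nat :=
  xget None [set K : option nat |
    if K is Some k then
      is_linear_code (Lex F d k) /\
      forall j : nat, is_linear_code (Lex F d j) -> (j <= k)%N
    else forall k : nat, is_linear_code (Lex F d k)].

(* Meaningful when only finitely many coordinates are not identically zero
   on L, in particular when L is finite. *)
Definition res_coords (p : nat) (L : set {poly 'F_p}) : seq nat :=
  sort leq (fset_set [set i : nat | exists2 x, L x & x`_i != 0]).

Definition Res (p : nat) (L : set {poly 'F_p}) :
    set 'rV['F_p]_(size (res_coords L)) :=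
  [set \row_j x`_(nth 0%N (res_coords L) j) | x in L].
Arguments Res {p} L _.

Definition row_hdist (p n : nat) (x y : 'rV['F_p]_n) : nat :=
  #|[pred i : 'I_n | x 0 i != y 0 i]|.

(* C, of length n, is a linear [m, k, d] code. *)
Definition is_nkd_code (p n : nat) (C : set 'rV['F_p]_n) (m k d : nat) : Prop :=
  [/\ n = m,
      exists2 V : {vspace 'rV['F_p]_n}, C = [set x | x \in V] & \dim V = k,
      forall x y, C x -> C y -> x <> y -> (d <= row_hdist x y)%N &
      exists x y, [/\ C x, C y, x <> y & row_hdist x y = d]].

(* The lengths m and n are equal whenever the bijection s exists. *)
Definition monomially_equivalent (p m n : nat)
    (C : set 'rV['F_p]_m) (D : set 'rV['F_p]_n) : Prop :=
  exists (s : 'I_n -> 'I_m) (u : 'I_n -> 'F_p),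
    [/\ bijective s, forall j, u j != 0 &
        D = [set \row_j (u j * x 0 (s j)) | x in C]].

Definition golay_matrix : 'M['F_3]_(6, 6 + 6) :=
  row_mx 1%:M (\matrix_(i, j)
    (nth 0%N (nth [::] [:: [:: 0; 1; 1; 1; 1; 1];
                           [:: 1; 0; 1; 2; 2; 1];
                           [:: 1; 1; 0; 1; 2; 2];
                           [:: 1; 2; 1; 0; 1; 2];
                           [:: 1; 2; 2; 1; 0; 1];
                           [:: 1; 1; 2; 2; 1; 0]]%N i) j)%:R).

(* The second condition follows from the first by the uniqueness of the
   [12, 6, 6] code over 'F_3 up to monomial equivalence; requiring it makes
   the definition independent of that theorem. *)
Definition is_ternary_golay (n : nat) (C : set 'rV['F_3]_n) : Prop :=
  is_nkd_code C 12 6 6 /\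
  monomially_equivalent C [set u *m golay_matrix | u in [set: 'rV['F_3]_6]].

(* Main.v *)
Require Import Defs.
From HB Require Import structures.
From mathcomp Require Import all_boot all_order all_algebra finmap.
From mathcomp Require Import all_classical.
From mathcomp Require Import zify.
From Stdlib Require String.
Import String.StringSyntax.

(** Let [w_0, w_1, ...] be the lexicographic code, [C] a linear code spanned by
    [G] and [v] a word whose size in the basis exceeds that of [C]. If [C] and
    its coset [v + C] have minimum weight 6, and every [y < v] is at distance at
    most 5 from some [c <= y] in [C], then [C] consists of the first [|C|] words
    and [v] is the next one. If moreover [z < u] with [u] in [C + <v>] and [z]
    is at distance at least 6 from all words of [C + <v>] below [u], then no
    larger lexicographic code is linear: it would contain [C + <v>], and below
    [u] nothing else, so the greedy choice would have preferred [z] to [u].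

    All this happens within a bounded number of coordinates, which leaves finitely
    many cases. For [xi >= 9] the basis is standard on the 9 coordinates that
    matter, and for [xi <= 8], [eta >= 10] the index [eta] lies beyond the 10
    coordinates that matter, so that it only counts coordinate [xi] twice. The
    covering condition is verified by a tree search. For [eta = 9] the code is the
    Golay code on 12 coordinates, whose covering radius 3 forces [v] to have three
    further coordinates. *)

Set Implicit Arguments.
Unset Strict Implicit.
Unset Printing Implicit Defensive.

(** * Hamming weight, and the order as comparison of numbers in base 3 *)

Section Weights.
Import GRing.Theory.
Local Open Scope ring_scope.
Implicit Types (x y : {poly 'F_3}) (s t : seq 'F_3).

Definition wt x : nat := count (fun c => c != 0) x.

Lemma count_neq0 s :
  count (fun c => c != 0) s = (\sum_(i < size s) (s`_i != 0)%R)%N.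
Proof.
rewrite -sum1_count (big_nth 0) big_mkord big_mkcond /=.
by apply: eq_bigr => i _; case: (_ != _).
Qed.

(** Any bound [n] on the length serves, so that the weights of several words can be compared index
    by index over a common range. *)
Lemma wtE n x : (size x <= n)%N -> wt x = (\sum_(i < n) (x`_i != 0)%R)%N.
Proof.
move=> le_x_n; rewrite /wt count_neq0.
rewrite (@big_ord_widen _ 0%N addn _ n (fun i : nat => (x`_i != 0)%R : nat) le_x_n).
rewrite big_mkcond; apply: eq_bigr => i _.
by case: ltnP => [//|/(nth_default 0) ->]; rewrite eqxx.
Qed.

Lemma wt0 : wt 0 = 0%N.
Proof. by rewrite /wt polyseq0. Qed.

Lemma wt_eq0 x : (wt x == 0)%N = (x == 0).
Proof.
apply/idP/eqP => [|->]; last by rewrite wt0.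
rewrite (wtE (leqnn _)) sum_nat_eq0 => /forallP x0.
apply/polyP => i; rewrite coef0; case: (ltnP i (size x)) => [lti|/(nth_default 0)//].
by have := x0 (Ordinal lti); rewrite eqb0 negbK => /eqP.
Qed.

Lemma wtD x y : (wt (x + y)%R <= wt x + wt y)%N.
Proof.
have lex : (size x <= maxn (size x) (size y))%N by rewrite leq_maxl.
have ley : (size y <= maxn (size x) (size y))%N by rewrite leq_maxr.
rewrite (wtE lex) (wtE ley) (wtE (size_polyD x y)) -big_split /=.
apply: leq_sum => i _; rewrite coefD.
case: (x`_i =P 0) => [->|_]; case: (y`_i =P 0) => [->|_];
  by rewrite ?add0r ?addr0 ?eqxx //=; case: (_ != _).
Qed.

Lemma wt_Poly s : wt (Poly s) = count (fun c => c != 0) s.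
Proof.
rewrite (wtE (size_Poly s)) count_neq0.
by apply: eq_bigr => i _; rewrite coef_Poly.
Qed.

Lemma hdist_wt x y : hdist x y = wt (x - y).
Proof.
have le_xy : (size (x - y)%R <= maxn (size x) (size y))%N.
  by rewrite (leq_trans (size_polyD _ _)) // size_polyN.
rewrite (wtE le_xy) /hdist -sum1_card big_mkcond /=.
by apply: eq_bigr => i _; rewrite inE coefB subr_eq0; case: (_ != _).
Qed.

(* [nu x] is [x] read as a number in base 3; it embeds the order of the
   coordinate sequences into the order of the naturals. *)
Definition nu x : nat := foldr (fun (c : 'F_3) n => (c + 3 * n)%N) 0%N x.

Lemma nu_Poly s : nu (Poly s) = foldr (fun (c : 'F_3) n => (c + 3 * n)%N) 0%N s.
Proof.
elim: s => [|c s IHs] /=; first by rewrite /nu polyseq0.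
rewrite -IHs /nu polyseq_cons; case: nilP => [s0|//].
by rewrite s0 polyseqC; case: eqP => [->|_] /=.
Qed.

(** Digits are at most 2, so a strict inequality between the higher parts outweighs the lowest
    digit. The induction on [N] removes lowest digits. *)
Lemma nu_lt_coef x y N :
  ((x`_N)%R < (y`_N)%R)%N -> (forall i, (N < i)%N -> x`_i = y`_i) -> (nu x < nu y)%N.
Proof.
rewrite /nu; move: (polyseq x) (polyseq y) => {x y} s t.
(* From here on the lists are arbitrary and may end in zeros, so lists with the same digits need not
   be equal; only their values are. *)
have eq_foldr u v : (forall i, u`_i = v`_i) ->
    foldr (fun (c : 'F_3) n => c + 3 * n)%N 0%N u =
    foldr (fun (c : 'F_3) n => c + 3 * n)%N 0%N v.
  move=> eq_uv; rewrite -!nu_Poly; congr nu.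
  by apply/polyP => i; rewrite !coef_Poly.
elim: N s t => [|N IHN] s t lt_st eq_st; last first.
  have {IHN} := IHN (behead s) (behead t); rewrite !nth_behead => /(_ lt_st).
  have b_st i : (N < i)%N -> (behead s)`_i = (behead t)`_i.
    by move=> ltNi; rewrite !nth_behead eq_st.
  move/(_ b_st); case: (s) (t) => [|c s'] [|d t'] //=; first lia.
  by have : (c < 3)%N := ltn_ord c; lia.
have: forall i, (behead s)`_i = (behead t)`_i.
  by move=> i; rewrite !nth_behead eq_st.
move/eq_foldr; move: lt_st {eq_st}.
by case: s t => [|c s] [|d t] //=; lia.
Qed.

Lemma nu_total x y : x <> y ->
  exists N, x`_N <> y`_N /\ forall i, (N < i)%N -> x`_i = y`_i.
Proof.
move=> neq_xy; have exN : exists N, x`_N != y`_N.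
  apply: contrapT => noN; apply: neq_xy; apply/polyP => i; apply/eqP.
  by apply: contrapT => xi; apply: noN; exists i; apply/negP.
have ubN i : x`_i != y`_i -> (i <= size (x - y)%R)%N.
  by rewrite -subr_eq0 -coefB; apply: contraR; rewrite -ltnNge => /ltnW/(nth_default 0) ->.
case: (ex_maxnP exN ubN) => N /eqP xyN maxN; exists N; split=> // i ltNi.
by apply/eqP; apply: contraTT ltNi => /maxN; rewrite -leqNgt.
Qed.

Lemma nu_inj : injective nu.
Proof.
move=> x y eq_nu; apply: contrapT => /nu_total[N [xyN eqN]].
have /orP[lt|lt] : ((x`_N)%R < (y`_N)%R)%N || ((y`_N)%R < (x`_N)%R)%N.
  by rewrite -neq_ltn; apply/eqP => /val_inj.
- by have := nu_lt_coef lt eqN; rewrite eq_nu ltnn.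
- by have := nu_lt_coef lt (fun i Ni => esym (eqN i Ni)); rewrite eq_nu ltnn.
Qed.

Lemma nu_ltP x y : (nu x < nu y)%N <->
  exists N, ((x`_N)%R < (y`_N)%R)%N /\ forall i, (N < i)%N -> x`_i = y`_i.
Proof.
split=> [lt_xy|[N [lt eqN]]]; last exact: nu_lt_coef lt eqN.
have [|N [xyN eqN]] := @nu_total x y; first by move=> xy; rewrite xy ltnn in lt_xy.
exists N; split=> //; rewrite ltnNge leq_eqVlt; apply/norP; split.
  by apply/eqP => /val_inj/esym.
apply/negP => lt; have := nu_lt_coef lt (fun i Ni => esym (eqN i Ni)).
by rewrite ltnNge ltnW.
Qed.

Lemma size_lt_nu x y : (size x < size y)%N -> (nu x < nu y)%N.
Proof.
case sy: (size y) => [//|n] lt_xn; apply/nu_ltP.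
exists n; split=> [|i lt_ni]; last first.
  by rewrite !nth_default ?sy //; apply: leq_trans lt_ni; apply: ltnW.
rewrite [x`_n]nth_default // lt0n; apply/eqP => yn0.
have: lead_coef y = 0 by apply: val_inj; rewrite lead_coefE sy.
by move/eqP; rewrite lead_coef_eq0 => /eqP y0; rewrite y0 size_poly0 in sy.
Qed.

Lemma nu_le_size x y : (nu x <= nu y)%N -> (size x <= size y)%N.
Proof. by apply: contraTT; rewrite -!ltnNge; apply: size_lt_nu. Qed.

End Weights.

(** * Greedy words in the coordinates of a basis *)

Section LincombTheory.
Import GRing.Theory.
Local Open Scope ring_scope.
Variable F : nat -> {poly 'F_3}.

Lemma lincombE n (a : {poly 'F_3}) :
  (size a <= n)%N -> lincomb F a = \sum_(i < n) a`_i *: F i.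
Proof.
move=> le_an; rewrite /lincomb.
rewrite (@big_ord_widen _ 0 +%R _ n (fun i : nat => a`_i *: F i) le_an).
rewrite big_mkcond; apply: eq_bigr => i _.
by case: ltnP => [//|/(nth_default 0) ->]; rewrite scale0r.
Qed.

Lemma lincomb_is_linear : linear (lincomb F).
Proof.
move=> k a b; pose n := maxn (size a) (size b).
have le_a : (size a <= n)%N by rewrite leq_maxl.
have le_b : (size b <= n)%N by rewrite leq_maxr.
have le_ab : (size (k *: a + b)%R <= n)%N.
  apply: leq_trans (size_polyD _ _) _; rewrite geq_max le_b andbT.
  by apply: leq_trans (size_scale_leq _ _) le_a.
rewrite (lincombE le_a) (lincombE le_b) (lincombE le_ab) scaler_sumr -big_split.
by apply: eq_bigr => i _ /=; rewrite coefD coefZ scalerDl scalerA.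
Qed.
HB.instance Definition _ :=
  GRing.isLinear.Build 'F_3 {poly 'F_3} {poly 'F_3} _ (lincomb F) lincomb_is_linear.

Hypothesis lincombI : injective (lincomb F).
Hypothesis lincombS : forall x, exists a, lincomb F a = x.

(** Injectivity makes the coordinate sequences quantified in [lt_basis] unique. *)
Lemma lt_basisE a b : lt_basis F (lincomb F a) (lincomb F b) <-> (nu a < nu b)%N.
Proof.
rewrite nu_ltP; split=> [[a' [b' [/lincombI <- /lincombI <- //]]]|ab].
by exists a, b.
Qed.

(** Put [d] digits 1 beyond all the words of [s]. Hence the set minimised by [lexmin] is never
    empty. *)
Lemma far_word d (s : seq {poly 'F_3}) :
  exists z, forall c, c \in s -> (d <= hdist z c)%N.
Proof.
pose B := \max_(c <- s) size c; pose z : {poly 'F_3} := Poly (nseq B 0 ++ nseq d 1).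
exists z => c cs; rewrite hdist_wt.
have leB : (size c <= B)%N by rewrite /B (big_rem c cs) leq_maxl.
have le_z : (size z <= B + d)%N.
  by rewrite (leq_trans (size_Poly _)) // size_cat !size_nseq.
have le_zc : (size (z - c)%R <= B + d)%N.
  rewrite (leq_trans (size_polyD _ _)) // size_polyN geq_max le_z.
  exact: leq_trans leB (leq_addr _ _).
rewrite (wtE le_zc) big_split_ord /=.
rewrite [X in (_ <= _ + X)%N](eq_bigr (fun=> 1%N)) ?sum1_card ?card_ord ?leq_addl //.
move=> i _; rewrite coefB coef_Poly nth_cat size_nseq ltnNge leq_addr /=.
by rewrite addKn nth_nseq ltn_ord [c`_ _]nth_default ?subr0 // (leq_trans leB) ?leq_addr.
Qed.

Lemma mem_lexwords d n (c : {poly 'F_3}) :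
  c \in lexwords F d n <-> exists2 i, (i < n)%N & c = lexword F d i.
Proof.
elim: n => [|n IHn] /=; first by split=> // -[].
rewrite mem_rcons inE; split=> [/orP[/eqP ->|/IHn[i lti ->]]|[i]].
- by exists n.
- by exists i => //; apply: ltnW.
rewrite ltnS leq_eqVlt => /orP[/eqP -> ->|lti ci]; first by rewrite eqxx.
by apply/orP; right; apply/IHn; exists i.
Qed.

(** The greedy recursion, with the order replaced by [nu]. The values of [nu] on the admissible
    words form a nonempty set of naturals, so the minimum exists and the default of [xget] does not
    occur. *)
Lemma lexword_coords d : exists w : nat -> {poly 'F_3},
  [/\ forall n, lincomb F (w n) = lexword F d n,
      forall i n, (i < n)%N -> (d <= wt (lincomb F (w n - w i)%R))%N &
      forall n y, (forall i, (i < n)%N -> (d <= wt (lincomb F (y - w i)%R))%N) ->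
        (nu (w n) <= nu y)%N].
Proof.
have [w wE] := choice (fun n => lincombS (lexword F d n)); exists w.
have min n : [set z | (forall c, c \in lexwords F d n -> (d <= hdist z c)%N) /\
    forall y, (forall c, c \in lexwords F d n -> (d <= hdist y c)%N) -> y <> z ->
    lt_basis F z y]%classic (lincomb F (w n)).
  rewrite wE /lexword /lexnext /lexmin; apply: xgetPex => /=.
  pose P m := `[< exists a, nu a = m /\
    forall c, c \in lexwords F d n -> (d <= hdist (lincomb F a) c)%N >].
  have exP : exists m, P m.
    have [z far_z] := far_word d (lexwords F d n); have [a az] := lincombS z.
    by exists (nu a); apply/asboolP; exists a; rewrite az.
  have [m /asboolP[a [am far_a]] min_m] := ex_minnP exP.
  exists (lincomb F a); split=> // y far_y; have [b by_] := lincombS y.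
  rewrite -by_ => neq_ba; apply/lt_basisE; rewrite ltn_neqAle am min_m ?andbT.
    by apply/eqP; rewrite -am => /nu_inj ab; apply: neq_ba; rewrite ab.
  by apply/asboolP; exists b; rewrite by_.
split=> // [i n lt_in|n y far_y].
  rewrite linearB -hdist_wt /= !wE; have [+ _] := min n; rewrite wE; apply.
  by apply/mem_lexwords; exists i.
have [_ min_n] := min n; have [->//|neq_y] := eqVneq y (w n).
apply: ltnW; apply/lt_basisE; apply: min_n => [c /mem_lexwords[i lti ->]|].
  by rewrite hdist_wt -wE -linearB; apply: far_y.
by move/lincombI/eqP; apply/negP.
Qed.

End LincombTheory.

(** * Spans over the field of three elements, as explicit lists *)

Section Span.
Import GRing.Theory.
Local Open Scope ring_scope.

Lemma F3P (P : 'F_3 -> Prop) : P 0 -> P 1 -> P 2 -> forall c, P c.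
Proof.
move=> P0 P1 P2 [[|[|[|//]]] lt3].
- by have -> : Ordinal lt3 = 0 by apply: val_inj.
- by have -> : Ordinal lt3 = 1 by apply: val_inj.
- by have -> : Ordinal lt3 = 2 by apply: val_inj.
Qed.

Variable V : lmodType 'F_3.
Implicit Types (x y g : V) (G H : seq V).

(** A list with possible repetitions, so that the span can be both counted and computed; the
    multiples of [g] are 0, [g] and [g + g]. *)
Fixpoint lspan G : seq V :=
  if G is g :: G' then
    lspan G' ++ [seq g + c | c <- lspan G'] ++ [seq g + g + c | c <- lspan G']
  else [:: 0].

Lemma mem_lspan_cons g G x :
  x \in lspan (g :: G) <-> exists t, x - t *: g \in lspan G.
Proof.
rewrite /= !mem_cat; split=> [/or3P[xG|/mapP[c cG ->]|/mapP[c cG ->]]|[t]].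
- by exists 0; rewrite scale0r subr0.
- by exists 1; rewrite scale1r addrAC subrr add0r.
- by exists 2; rewrite scaler_nat mulr2n addrAC subrr add0r.
have eq_x a : x = a + (x - a) by rewrite addrC subrK.
elim/F3P: t; rewrite ?scale0r ?subr0 ?scale1r ?scaler_nat ?mulr2n => xG.
- by rewrite xG.
- by rewrite [X in X \in map _ _](eq_x g) map_f ?orbT.
- by rewrite [X in _ || (_ || (X \in _))](eq_x (g + g)) map_f ?orbT.
Qed.

Lemma lspan0 G : 0 \in lspan G.
Proof. by elim: G => [|g G IHG] /=; rewrite ?mem_cat ?IHG ?inE. Qed.

Lemma lspan_linear G a x y : x \in lspan G -> y \in lspan G -> a *: x + y \in lspan G.
Proof.
elim: G x y => [|g G IHG] x y.
  by rewrite !inE => /eqP-> /eqP->; rewrite scaler0 addr0.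
move=> /mem_lspan_cons[s xG] /mem_lspan_cons[t yG]; apply/mem_lspan_cons.
exists (a * s + t); have -> : a *: x + y - (a * s + t) *: g = a *: (x - s *: g) + (y - t *: g).
  by rewrite scalerDl -scalerA scalerBr opprD addrACA.
exact: IHG.
Qed.

Lemma lspanB G x y : x \in lspan G -> y \in lspan G -> x - y \in lspan G.
Proof. by move=> xG yG; rewrite addrC -scaleN1r lspan_linear. Qed.

Lemma lspanN G x : x \in lspan G -> - x \in lspan G.
Proof. by move=> xG; rewrite -sub0r lspanB ?lspan0. Qed.

Lemma lspanD G x y : x \in lspan G -> y \in lspan G -> x + y \in lspan G.
Proof. by move=> xG yG; rewrite -[x]scale1r lspan_linear. Qed.

Lemma size_lspan G : size (lspan G) = (3 ^ size G)%N.
Proof. by elim: G => //= g G IHG; rewrite !size_cat !size_map IHG expnS; lia. Qed.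

Lemma lspan_sub G H : {subset G <= lspan H} -> {subset lspan G <= lspan H}.
Proof.
elim: G => [|g G IHG] GH x; first by rewrite inE => /eqP ->; apply: lspan0.
move=> /mem_lspan_cons[t xG]; rewrite -(subrK (t *: g) x) addrC lspan_linear //.
  by rewrite GH ?mem_head.
by apply: IHG xG => y yG; rewrite GH // inE yG orbT.
Qed.

Lemma sub_lspan G : {subset G <= lspan G}.
Proof.
elim: G => // g G IHG x; rewrite inE => /orP[/eqP ->|/IHG xG].
  by apply/mem_lspan_cons; exists 1; rewrite scale1r subrr lspan0.
by rewrite /= mem_cat xG.
Qed.

(** The head is the trivial combination, so [behead] leaves the combinations with some nonzero
    coefficient. *)
Lemma lspan_behead G : lspan G = 0 :: behead (lspan G).
Proof. by elim: G => //= g G ->. Qed.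

(** A test of independence. The three cosets of the smaller span are disjoint: otherwise [g] or
    [g + g] would lie in it, and 0 would be a nontrivial combination. *)
Lemma lspan_uniq G : 0 \notin behead (lspan G) -> uniq (lspan G).
Proof.
elim: G => // g G IHG.
rewrite [X in behead X]/= [X in X ++ _]lspan_behead /= !mem_cat !negb_or.
case/and3P=> /IHG uG gG0 ggG0.
have gG : g \notin lspan G.
  by apply: contraNN gG0 => /lspanN gG; apply/mapP; exists (- g); rewrite ?subrr.
have ggG : g + g \notin lspan G.
  by apply: contraNN ggG0 => /lspanN gG'; apply/mapP; exists (- (g + g)); rewrite ?subrr.
rewrite !cat_uniq uG !(map_inj_uniq (addrI _)) uG /= andbT has_cat negb_or -andbA.
apply/and3P; split; apply/hasPn => _ /mapP[c cG ->].
- by apply: contraNN gG => /lspanB/(_ cG); rewrite addrK.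
- by apply: contraNN ggG => /lspanB/(_ cG); rewrite addrK.
apply: contraNN gG => /mapP[c' c'G /eqP]; rewrite -addrA (inj_eq (addrI _)).
by move=> /eqP eq_c'; have := lspanB c'G cG; rewrite -eq_c' addrK.
Qed.

End Span.

Lemma lspan_map (V W : lmodType 'F_3) (f : {linear V -> W}) (G : seq V) :
  lspan (map f G) = map f (lspan G).
Proof.
elim: G => [|g G IHG] /=; first by rewrite GRing.linear0.
rewrite IHG !map_cat -!map_comp; congr (_ ++ _ ++ _); apply: eq_map => c /=.
  by rewrite GRing.linearD.
by rewrite !GRing.linearD.
Qed.

(** * The greedy construction yields a given linear code *)

Section Greedy.
Import GRing.Theory.
Local Open Scope ring_scope.
Local Open Scope classical_set_scope.
Variables (F : nat -> {poly 'F_3}) (d : nat) (G : seq {poly 'F_3}) (v : {poly 'F_3}).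
Hypothesis lincombI : injective (lincomb F).
Hypothesis lincombS : forall x, exists a, lincomb F a = x.
Hypothesis d_gt0 : (0 < d)%N.
Hypothesis uniqG : uniq (lspan G).
Hypothesis dist_G : forall c, c \in lspan G -> c <> 0 -> (d <= wt (lincomb F c))%N.
Hypothesis cover_G : forall y, (nu y < nu v)%N -> exists c,
  [/\ c \in lspan G, (nu c <= nu y)%N & (wt (lincomb F (y - c)%R) < d)%N].
Hypothesis size_G : forall c, c \in lspan G -> (size c < size v)%N.
Hypothesis dist_v : forall c, c \in lspan G -> (d <= wt (lincomb F (v - c)%R))%N.

Section Words.
Variable w : nat -> {poly 'F_3}.
Hypothesis w_dist : forall i n, (i < n)%N -> (d <= wt (lincomb F (w n - w i)%R))%N.
Hypothesis w_min : forall n y,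
  (forall i, (i < n)%N -> (d <= wt (lincomb F (y - w i)%R))%N) -> (nu (w n) <= nu y)%N.

Lemma nu_word_lt i n : (i < n)%N -> (nu (w i) < nu (w n))%N.
Proof.
move=> lt_in; rewrite ltn_neqAle w_min ?andbT; last first.
  by move=> j lt_ji; apply: w_dist; apply: ltn_trans lt_in.
apply/eqP => /nu_inj eq_w; have := w_dist lt_in.
by rewrite eq_w subrr linear0 wt0 leqNgt d_gt0.
Qed.

Lemma nu_word_ltE i n : (nu (w i) < nu (w n))%N = (i < n)%N.
Proof.
apply/idP/idP; last exact: nu_word_lt.
apply: contraTT; rewrite -!leqNgt leq_eqVlt => /orP[/eqP -> //|/nu_word_lt/ltnW//].
Qed.

Lemma word_inj : injective w.
Proof.
by move=> i n eq_w; case: (ltngtP i n) => [/nu_word_lt|/nu_word_lt|//]; rewrite eq_w ltnn.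
Qed.

(** The words increase without bound, so some first word is not below [x]. As [x] was admissible at
    that stage, the greedy choice cannot exceed [x], hence equals it. *)
Lemma word_of_dist x :
  (forall i, (nu (w i) < nu x)%N -> (d <= wt (lincomb F (x - w i)%R))%N) ->
  exists a, w a = x.
Proof.
move=> dist_x; have ex_ge : exists a, (nu x <= nu (w a))%N.
  exists (nu x); elim: (nu x) => // m IHm.
  exact: leq_ltn_trans IHm (nu_word_lt _).
have [a le_xa min_a] := ex_minnP ex_ge; exists a; apply/nu_inj/eqP.
rewrite eqn_leq le_xa w_min // => i lt_ia; apply: dist_x.
by rewrite ltnNge; apply: contraL lt_ia => /min_a; rewrite leqNgt.
Qed.

(** Strong induction on [nu y]. If [y] is a word, the codeword covering it is either [y] or a
    smaller word at distance less than [d], which is impossible. If [y] is a codeword, all smaller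
    words are codewords, so [y] is admissible. *)
Lemma word_lt_vP y : (nu y < nu v)%N -> (exists a, w a = y) <-> y \in lspan G.
Proof.
have [n] := ubnP (nu y); elim: n y => // n IHn y lt_yn lt_yv.
have IH x : (nu x < nu y)%N -> (exists a, w a = x) <-> x \in lspan G.
  by move=> lt_xy; apply: IHn; [apply: leq_trans lt_xy _|apply: ltn_trans lt_yv].
split=> [[a wa]|yG].
  have [c [cG le_cy dist_c]] := cover_G lt_yv.
  have [<- //|neq_cy] := eqVneq c y.
  have lt_cy : (nu c < nu y)%N by rewrite ltn_neqAle le_cy (inj_eq nu_inj) neq_cy.
  have [_ /(_ cG)[b wb]] := IH c lt_cy.
  have lt_ba : (b < a)%N by rewrite -nu_word_ltE wa wb.
  by have := w_dist lt_ba; rewrite wa wb leqNgt dist_c.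
apply: word_of_dist => i lt_iy; have [/(_ (ex_intro _ i erefl)) iG _] := IH _ lt_iy.
apply: dist_G; first exact: lspanB.
by move/eqP; rewrite subr_eq0 => /eqP eq_iy; rewrite eq_iy ltnn in lt_iy.
Qed.

(** By [dist_v] the vector [v] is itself a word, and its index counts the words below it, which are
    exactly the codewords. *)
Lemma word_card : w (3 ^ size G) = v.
Proof.
have [a wa] : exists a, w a = v.
  apply: word_of_dist => i /word_lt_vP[+ _] => /(_ (ex_intro _ i erefl)).
  exact: dist_v.
suff -> : (3 ^ size G)%N = a by [].
rewrite -(size_lspan G) -(size_iota 0 a) -(size_map w).
apply/perm_size/uniq_perm => // [|c].
  by rewrite map_inj_uniq ?iota_uniq //; exact: word_inj.
apply/idP/mapP => [cG|[i + ->]].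
  have lt_cv := size_lt_nu (size_G cG); have [_ /(_ cG)[i wi]] := word_lt_vP lt_cv.
  by exists i => //; rewrite mem_iota -nu_word_ltE wi wa.
rewrite mem_iota /= add0n -nu_word_ltE wa => /word_lt_vP[+ _]; apply.
by exists i.
Qed.

Lemma wordP c : c \in lspan G <-> exists2 a, (a < 3 ^ size G)%N & w a = c.
Proof.
split=> [cG|[a + <-]].
  have lt_cv := size_lt_nu (size_G cG); have [_ /(_ cG)[i wi]] := word_lt_vP lt_cv.
  by exists i => //; rewrite -nu_word_ltE wi word_card.
by rewrite -nu_word_ltE word_card => /word_lt_vP[+ _]; apply; exists a.
Qed.

End Words.

Lemma Lex_lspan : Lex F d (size G) = [set lincomb F c | c in [set` lspan G]].
Proof.
have [w [wE w_dist w_min]] := lexword_coords lincombI lincombS d.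
apply/seteqP; split=> x [c].
  move=> /= lt_a <-; exists (w c) => //=; rewrite ?wE //.
  by apply/(wordP w_dist w_min); exists c.
by move=> /= /(wordP w_dist w_min)[a lt_a <-] <-; exists a; rewrite ?wE.
Qed.

Lemma Lex_linear : is_linear_code (Lex F d (size G)).
Proof.
rewrite Lex_lspan; split=> [|a x y]; rewrite !inE.
  by exists 0; rewrite /= ?lspan0 ?linear0.
move=> [c /= cG <-] [e /= eG <-]; exists (a *: c + e); rewrite ?linearP //=.
exact: lspan_linear.
Qed.

Variables (z u : {poly 'F_3}).
Hypothesis z_lt_u : (nu z < nu u)%N.
Hypothesis u_in : u \in lspan (v :: G).
Hypothesis dist_z : forall c, c \in lspan (v :: G) -> (nu c < nu u)%N ->
  (d <= wt (lincomb F (z - c)%R))%N.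

(* Below [u], a linear lexicographic code of larger dimension is spanned by the
   first words and [v], so it would have to contain [z] instead of [u]. *)
Lemma Lex_nonlinear j : is_linear_code (Lex F d j) -> (j <= size G)%N.
Proof.
have [w [wE w_dist w_min]] := lexword_coords lincombI lincombS d.
move=> [_ linL]; rewrite leqNgt; apply/negP => lt_Gj.
pose D := [set c | exists2 a, (a < 3 ^ j)%N & w a = c].
have D_linear t x y : D x -> D y -> D (t *: x + y).
  move=> [a lt_a wa] [b lt_b wb].
  have := linL t (lincomb F x) (lincomb F y); rewrite !inE.
  have Lx : Lex F d j (lincomb F x) by exists a => //; rewrite -wE wa.
  have Ly : Lex F d j (lincomb F y) by exists b => //; rewrite -wE wb.
  move=> /(_ Lx Ly)[e /= lt_e]; rewrite -wE -linearP => /lincombI we.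
  by exists e.
have lt_3 : (3 ^ size G < 3 ^ j)%N by rewrite ltn_exp2l.
have D_G c : c \in lspan G -> D c.
  move=> /(wordP w_dist w_min)[a lt_a <-]; exists a => //.
  exact: ltn_trans lt_3.
have D_v : D v by exists (3 ^ size G)%N; rewrite ?(word_card w_dist w_min).
have D_vG c : c \in lspan (v :: G) -> D c.
  move=> /mem_lspan_cons[t /D_G cG]; rewrite -(subrK (t *: v) c) addrC.
  exact: D_linear.
have size_v : (0 < size v)%N by apply: leq_ltn_trans (size_G (lspan0 G)).
have size_vG c : c \in lspan (v :: G) -> (size c <= size v)%N.
  move=> /mem_lspan_cons[t /size_G/ltnW cG]; rewrite -(subrK (t *: v) c).
  rewrite (leq_trans (size_polyD _ _)) // geq_max cG.
  exact: leq_trans (size_scale_leq _ _) _.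
have D_lt_u c : D c -> (nu c < nu u)%N -> c \in lspan (v :: G).
  move=> Dc /ltnW/nu_le_size lt_cu.
  have le_cv : (size c <= size v)%N by apply: leq_trans lt_cu (size_vG _ u_in).
  (* Subtracting this multiple of [v] clears the digit at the top index of [v]; the difference is
     shorter than [v], where all words are known to lie in the span of [G]. *)
  pose t := c`_(size v).-1 / lead_coef v.
  apply/mem_lspan_cons; exists t.
  have D_tv : D (c - t *: v) by rewrite addrC -scaleNr; apply: D_linear.
  have : (size (c - t *: v)%R < size v)%N.
    rewrite -(prednK size_v) ltnS; apply/leq_sizeP => i le_vi.
    rewrite coefB coefZ; move: le_vi; rewrite leq_eqVlt => /orP[/eqP <-|lt_vi].
      rewrite -lead_coefE divfK ?subrr // lead_coef_eq0 -size_poly_eq0.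
      by rewrite -lt0n.
    rewrite (prednK size_v) in lt_vi; rewrite !nth_default ?mulr0 ?subr0 //.
    exact: leq_trans le_cv lt_vi.
  move=> /size_lt_nu/(word_lt_vP w_dist w_min)[+ _]; apply.
  by have [a _ wa] := D_tv; exists a.
have [a lt_a wa] := D_vG _ u_in.
have : (nu u <= nu z)%N.
  rewrite -wa; apply: (w_min) => i lt_ia; apply: dist_z.
    apply: D_lt_u; first by exists i => //; apply: ltn_trans lt_a.
    by rewrite -wa (nu_word_lt w_dist w_min).
  by rewrite -wa (nu_word_lt w_dist w_min).
by rewrite leqNgt z_lt_u.
Qed.

Lemma maxlin_lspan : maxlin F d = Some (size G).
Proof.
apply: xget_unique => [|[k|]] /=.
- by split; [exact: Lex_linear|exact: Lex_nonlinear].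
- move=> [lin_k max_k]; congr Some; apply/eqP.
  by rewrite eqn_leq (Lex_nonlinear lin_k) max_k //; apply: Lex_linear.
by move=> /(_ (size G).+1)/Lex_nonlinear; rewrite ltnn.
Qed.

End Greedy.

(** * Ternary words as plain data, for evaluation by [vm_compute] *)

Inductive trit := T0 | T1 | T2.

Definition teq a b :=
  match a, b with T0, T0 | T1, T1 | T2, T2 => true | _, _ => false end.

Lemma teqP : Equality.axiom teq.
Proof. by do 2 case; constructor. Qed.

HB.instance Definition _ := hasDecEq.Build trit teqP.

Definition tadd a b :=
  match a, b with
  | T0, c | c, T0 => c
  | T1, T1 => T2 | T2, T2 => T1
  | _, _ => T0
  end.

Definition tcmp a b :=
  match a, b with
  | T0, T0 | T1, T1 | T2, T2 => Eq
  | T0, _ | T1, T2 => Lt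
  | _, _ => Gt
  end.

Definition t2n a := match a with T0 => 0 | T1 => 1 | T2 => 2 end.

(* Words list their digits from the lowest index, and stand for a sequence
   that vanishes beyond the end of the list. *)
Notation word := (seq trit).

Fixpoint wadd (s t : word) : word :=
  match s, t with
  | [::], _ => t
  | _, [::] => s
  | a :: s', b :: t' => tadd a b :: wadd s' t'
  end.

Fixpoint wspan (G : seq word) : seq word :=
  if G is g :: G' then
    wspan G' ++ [seq wadd g c | c <- wspan G'] ++ [seq wadd (wadd g g) c | c <- wspan G']
  else [:: [::]].

Definition twt (s : word) : nat := count (predC (teq T0)) s.

Definition t2N a : BinNums.N :=
  match a with
  | T0 => BinNums.N0
  | T1 => BinNums.Npos BinNums.xH
  | T2 => BinNums.Npos (BinNums.xO BinNums.xH)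
  end.

(** The value [nu] in binary: words of 15 digits are compared, whose unary values would reach the
    order of [3 ^ 15]. *)
Fixpoint wval (s : word) : BinNums.N :=
  if s is a :: s' then
    BinNat.N.add (t2N a) (BinNat.N.mul (BinNums.Npos (BinNums.xI BinNums.xH)) (wval s'))
  else BinNums.N0.

(** Passage from coordinates in [F(xi, eta)] to standard ones: since the basis vector of index [xi]
    is the sum of two standard vectors, its digit is added at [eta]. *)
Definition shear xi eta (s : word) : word :=
  wadd s (rcons (nseq eta T0) (nth T0 s xi)).

Section TritTheory.
Import GRing.Theory.
Local Open Scope ring_scope.

Definition t2F a : 'F_3 := match a with T0 => 0 | T1 => 1 | T2 => 2 end.

Definition f2t (c : 'F_3) : trit := if c == 0 then T0 else if c == 1 then T1 else T2.

Lemma f2tK : cancel f2t t2F.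
Proof. by elim/F3P. Qed.

Lemma t2FK : cancel t2F f2t.
Proof. by case. Qed.

Lemma t2F_eq0 a : (t2F a != 0) = ~~ teq T0 a.
Proof. by case: a. Qed.

Lemma t2F_nat a : t2F a = t2n a :> nat.
Proof. by case: a. Qed.

Lemma t2FD a b : t2F (tadd a b) = t2F a + t2F b.
Proof. by case: a; case: b; apply/eqP. Qed.

Definition pol (s : word) : {poly 'F_3} := Poly (map t2F s).

Lemma coef_pol s i : (pol s)`_i = t2F (nth T0 s i).
Proof.
rewrite coef_Poly; case: (ltnP i (size s)) => lti; first by rewrite (nth_map T0).
by rewrite !nth_default ?size_map.
Qed.

Lemma size_pol s : (size (pol s) <= size s)%N.
Proof. by rewrite -(size_map t2F) size_Poly. Qed.

Lemma nth_wadd s t i : nth T0 (wadd s t) i = tadd (nth T0 s i) (nth T0 t i).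
Proof.
elim: s t i => [|a s IHs] [|b t] [|i] //=.
- by case: a.
- by case: (nth _ _ _).
Qed.

Lemma polD s t : pol (wadd s t) = pol s + pol t.
Proof. by apply/polyP => i; rewrite coefD !coef_pol nth_wadd t2FD. Qed.

Lemma pol_span G : map pol (wspan G) = lspan (map pol G).
Proof.
elim: G => [|g G IHG] //=; rewrite !map_cat -!map_comp -IHG.
congr (_ ++ _ ++ _); rewrite -map_comp; apply: eq_map => c /=; by rewrite !polD.
Qed.

Lemma wt_pol s : wt (pol s) = twt s.
Proof. by rewrite wt_Poly count_map; apply: eq_count => a /=; rewrite t2F_eq0. Qed.

Lemma nu_pol s : nu (pol s) = foldr (fun a n => t2n a + 3 * n)%N 0%N s.
Proof. by rewrite nu_Poly; elim: s => //= a s ->; rewrite t2F_nat. Qed.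

Lemma wvalE s : nu (pol s) = BinNat.N.to_nat (wval s).
Proof.
rewrite nu_pol; elim: s => // a s IHs.
rewrite -[wval _]/(BinNat.N.add (t2N a) (BinNat.N.mul _ (wval s))).
by rewrite Nnat.N2Nat.inj_add Nnat.N2Nat.inj_mul -IHs; case: a.
Qed.

Lemma word_of_poly n (y : {poly 'F_3}) :
  (size y <= n)%N -> exists2 s, size s = n & pol s = y.
Proof.
move=> le_yn; exists (mkseq (fun i => f2t y`_i) n); first by rewrite size_mkseq.
apply/polyP => i; rewrite coef_pol; case: (ltnP i n) => lti.
  by rewrite nth_mkseq // f2tK.
by rewrite !nth_default ?size_mkseq // (leq_trans le_yn).
Qed.

Definition sh xi eta (a : {poly 'F_3}) : {poly 'F_3} := a + a`_xi *: 'X^eta.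

Lemma sh_is_linear xi eta : linear (sh xi eta).
Proof.
move=> k a b; rewrite /sh coefD coefZ scalerDl -scalerA scalerDr.
by rewrite addrACA.
Qed.
HB.instance Definition _ xi eta :=
  GRing.isLinear.Build 'F_3 {poly 'F_3} {poly 'F_3} _ (sh xi eta) (sh_is_linear xi eta).

Lemma nth_shear xi eta s i :
  nth T0 (shear xi eta s) i =
  if i == eta then tadd (nth T0 s i) (nth T0 s xi) else nth T0 s i.
Proof.
rewrite nth_wadd nth_rcons size_nseq nth_nseq.
by case: ltngtP => //; case: (nth _ _ _).
Qed.

Lemma pol_shear xi eta s : pol (shear xi eta s) = sh xi eta (pol s).
Proof.
apply/polyP => i; rewrite coefD coefZ coefXn !coef_pol nth_shear.
by case: eqP => _; rewrite ?mulr1 ?mulr0 ?addr0 // t2FD.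
Qed.

End TritTheory.

(** * Tree search for the covering condition *)

(* A pair holds a digit in the basis under consideration and the standard
   digit of the same index; both sequences run downwards from the top index. *)
Notation profile := (seq (trit * trit)).

Inductive entry := Entry of profile & nat & bool.

(** Compares one digit of [y], in [p], with that of an entry, in [q]. It fails if the entry becomes
    larger than [y], or if the standard digits differ and the budget is spent. Starting with [st]
    true disregards the order. *)
Definition advance (p q : trit * trit) (b : nat) (st : bool) : option (nat * bool) :=
  match (if st then Lt else tcmp q.1 p.1) with
  | Gt => None
  | o =>
    let st' := if o is Lt then true else false in
    if teq q.2 p.2 then Some (b, st') else
    if b is b'.+1 then Some (b', st') else None
  end.

(* [st] records that the digits already read make the entry smaller than [y],
   [b] bounds the number of further standard digits in which they may differ. *)
Fixpoint fits (y e : profile) (b : nat) (st : bool) : bool :=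
  match y, e with
  | p :: y', q :: e' => if advance p q b st is Some (b', st') then fits y' e' b' st' else false
  | _, _ => true
  end.

Definition efits y e := let: Entry q b st := e in fits y q b st.

(** The result [None] is success: some entry fits whatever [r] digits follow, because its budget
    pays for all of them and its order is settled, either by being smaller already or by having only
    zeros left. *)
Fixpoint step (p : trit * trit) (r nd : nat) (E : seq entry) : option (seq entry) :=
  match E with
  | [::] => Some [::]
  | Entry (q :: e) b st :: E' =>
    match advance p q b st with
    | None => step p r nd E'
    | Some (b', st') =>
      if (r <= b') && (st' || all (fun x => teq T0 x.1) e) then None else
      if step p r nd E' is Some E'' then
        Some (if nd <= b' then Entry e b' st' :: E'' else E'')
      else None
    end
  | _ :: E' => step p r nd E'
  end.

(* Depth-first search through the profiles allowed by [opts]. The entries kept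
   at each node are only those with a budget of at least [nd], which loses no
   soundness; a profile that is left without entries is tested against [full]. *)
Fixpoint cover (full : seq entry) (pre : profile) (opts : seq profile)
    (need : seq nat) (E : seq entry) : bool :=
  if opts is o :: opts' then
    all (fun p => if step p (size opts') (head 0 need) E is Some E'
                  then cover full (p :: pre) opts' (behead need) E' else true) o
  else has (efits (rev pre)) full.

Definition esize n e := let: Entry q _ _ := e in size q == n.

Lemma fits_all y e b st :
  size e = size y -> size e <= b -> st || all (fun x => teq T0 x.1) e -> fits y e b st.
Proof.
elim: y e b st => [|[p p'] y IHy] [|[q q'] e] b st //= [sz].
case: b => // b le_b; rewrite /advance /=.
case: st => /= [_|]; last first.
  case: q => //= e0; case: p => /=; case: (teq q' p');
    by apply: IHy; rewrite ?e0 ?orbT //; lia.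
by case: (teq q' p'); apply: IHy => //; lia.
Qed.

Lemma stepP p r nd E : all (esize r.+1) E ->
  if step p r nd E is Some E' then
    all (esize r) E' /\ forall y, has (efits y) E' -> has (efits (p :: y)) E
  else forall y, size y = r -> has (efits (p :: y)) E.
Proof.
elim: E => [|[[|q e] b st] E IHE] //= /andP[/eqP[sz] /IHE {IHE}].
rewrite {1}/fits -/fits; case: (advance p q b st) => [[b' st']|] /=; last first.
  by case: (step p r nd E).
case: ifP => [/andP[le_rb e0] _ y sz_y|_].
  by rewrite fits_all // ?sz ?sz_y.
case: (step p r nd E) => [E' [szE' IH]|IH y sz_y]; last by rewrite IH ?orbT.
case: ifP => _ /=; last by split=> // y /IH ->; rewrite orbT.
by rewrite sz eqxx szE'; split=> // y /orP[->|/IH->]; rewrite ?orbT.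
Qed.

(** Induction on the remaining digits. The second hypothesis is the invariant: an entry surviving
    the prefix and fitting the suffix [y] comes from an entry of [full] that fits the whole profile;
    [pre] is kept in reverse. *)
Lemma coverP full pre opts need E :
  all (esize (size opts)) E ->
  (forall y, has (efits y) E -> has (efits (catrev pre y)) full) ->
  cover full pre opts need E ->
  forall y, all2 (fun p (o : profile) => p \in o) y opts -> has (efits (catrev pre y)) full.
Proof.
elim: opts pre need E => [|o opts IHo] pre need E szE goodE /=.
  by move=> + [|] //=; rewrite catrevE cats0.
move=> /allP cov [|p y] //= /andP[/cov + yo].
have := stepP p (head 0 need) szE; case: step => [E' [szE' IH]|IH _]; last first.
  by apply: goodE; rewrite IH // (eqP (proj1 (andP (etrans (esym (all2E _ _ _)) yo)))).
by move=> covE'; apply: IHo covE' y yo => // y /IH/goodE.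
Qed.

(* [g] is the digit of index [xi], which is guessed at the root of the search, as
   the standard digit of index [eta] depends on it. *)
Definition options xi eta (free : seq nat) g i : profile :=
  [seq (d, if i == eta then tadd d g else d) | d <- [:: T0; T1; T2] &
     ((i == xi) ==> teq g d) && ((i \in free) || teq T0 d)].
Arguments options : simpl never.

Definition opts xi eta L free g : seq profile :=
  [seq options xi eta free g i | i <- rev (iota 0 L)].

Definition prof xi eta L (s : word) : profile :=
  let s' := shear xi eta s in [seq (nth T0 s i, nth T0 s' i) | i <- rev (iota 0 L)].

Definition entries xi eta L (W : seq (word * nat * bool)) : seq entry :=
  [seq Entry (prof xi eta L c.1.1) c.1.2 c.2 | c <- W].

Definition covers xi eta L free need W : bool :=
  let E := entries xi eta L W in
  all (fun g => cover E [::] (opts xi eta L free g) need E) [:: T0; T1; T2].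

(** As digits are read from the top, [foldl] computes the value; the arbitrary start [m] stands for
    the common higher digits and makes the induction go through. *)
Lemma fitsP y e b st : size e = size y -> fits y e b st ->
  (forall m, st ||
   (foldl (fun n x => t2n x.1 + 3 * n) m e <= foldl (fun n x => t2n x.1 + 3 * n) m y)) /\
  count (fun x => ~~ teq x.1.2 x.2.2) (zip y e) <= b.
Proof.
(* A lead gained at a higher digit is never made up by equally many lower digits. *)
have foldl_lt u u' m m' : size u = size u' -> m < m' ->
    foldl (fun n (x : trit * trit) => t2n x.1 + 3 * n) m u <
    foldl (fun n x => t2n x.1 + 3 * n) m' u'.
  elim: u u' m m' => [|p u IHu] [|p' u'] m m' //= [sz] lt_m.
  by apply: IHu => //; case: p.1 => /=; lia.
elim: y e b st => [|[p p'] y IHy] [|[q q'] e] b st //=.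
  by split=> // m; rewrite leqnn orbT.
case=> sz.
rewrite /advance /=.
have -> : teq p' q' = teq q' p' by case: (p'); case: (q').
case: st => /=.
  case: (teq q' p') => [/(IHy _ _ _ sz)[_ ?]|]; first by [].
  by case: b => // b /(IHy _ _ _ sz)[_ ?].
case cmp: (tcmp q p) => //=.
  have -> : q = p by move: cmp; case: (q); case: (p).
  case: (teq q' p') => [/(IHy _ _ _ sz)[le ?]|]; first by split=> // m; apply: (le (_ + _)).
  by case: b => // b /(IHy _ _ _ sz)[le ?]; split=> // m; apply: (le (_ + _)).
have le m : foldl (fun n (x : trit * trit) => t2n x.1 + 3 * n) (t2n q + 3 * m) e <=
    foldl (fun n x => t2n x.1 + 3 * n) (t2n p + 3 * m) y.
  by apply/ltnW/foldl_lt => //; move: cmp; case: (q); case: (p) => //= _; lia.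
case: (teq q' p') => [/(IHy _ _ _ sz)[_ ?]|]; first by split.
by case: b => // b /(IHy _ _ _ sz)[_ ?]; split.
Qed.

(** * From the search back to polynomials *)

Section Covers.
Import GRing.Theory.
Local Open Scope ring_scope.

Lemma nu_prof xi eta L s : (size s <= L)%N ->
  foldl (fun n x => t2n x.1 + 3 * n)%N 0%N (prof xi eta L s) = nu (pol s).
Proof.
move=> le_sL; rewrite /prof /= map_rev foldl_rev.
have -> : pol s = pol (mkseq (nth T0 s) L).
  apply/polyP => i; rewrite !coef_pol; case: (ltnP i L) => lti.
    by rewrite nth_mkseq.
  by rewrite !nth_default ?size_mkseq // (leq_trans le_sL).
by rewrite nu_pol /mkseq; elim: (iota 0 L) => //= i l ->.
Qed.

(** The search is used with the guess equal to the true digit of [y] at [xi]; the bound on [eta]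
    keeps the sheared words within [L] digits. *)
Lemma coversP xi eta L free need (W : seq (word * nat * bool)) (y : {poly 'F_3}) :
  (eta < L)%N -> all (fun c => size c.1.1 <= L)%N W ->
  covers xi eta L free need W ->
  (size y <= L)%N -> (forall i, i \notin free -> y`_i = 0) ->
  exists2 c, c \in W & (c.2 || (nu (pol c.1.1) <= nu y)%N) &&
    (wt (sh xi eta (y - pol c.1.1)) <= c.1.2)%N.
Proof.
move=> lt_eta szW /allP covW le_yL; have [s sz_s <-] := word_of_poly le_yL => y0.
have /covW/coverP cov : nth T0 s xi \in [:: T0; T1; T2] by case: (nth _ _ _).
have cov_s : has (efits (prof xi eta L s)) (entries xi eta L W).
  apply: cov => //; first by rewrite all_map; apply/allP => c cW; rewrite /= !size_map.
  rewrite all2E /prof /opts !size_map eqxx /= zip_map all_map.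
  apply/allP => i _ /=; rewrite nth_shear /options; apply/mapP; exists (nth T0 s i) => //.
  rewrite mem_filter; apply/andP; split; last by case: (nth _ _ _).
  apply/andP; split; first by apply/implyP => /eqP ->; case: (nth _ _ _).
  by case: (boolP (i \in free)) => //= /y0; rewrite coef_pol => /(congr1 f2t); rewrite t2FK => ->.
move: cov_s; rewrite has_map => /hasP[[[c b] st] cW] /= /fitsP[|le cnt].
  by rewrite !size_map.
exists (c, b, st) => //=; apply/andP; split.
  by have := le 0%N; rewrite !nu_prof ?sz_s //; apply: (allP szW _ cW).
rewrite linearB /= -!pol_shear; apply: leq_trans cnt.
rewrite zip_map count_map count_rev -sum1_count -{1}[L]subn0 -/(index_iota 0 L).
rewrite big_mkord big_mkcond /= (@wtE L).
  apply/eq_leq/eq_bigr => i _; rewrite coefB !coef_pol subr_eq0 (can_eq t2FK).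
  by rewrite -[_ == _]/(teq _ _); case: teq.
apply/leq_sizeP => i le_Li; rewrite coefB !coef_pol !nth_shear.
rewrite gtn_eqF ?(leq_trans lt_eta) // !nth_default ?subrr ?sz_s //.
by apply: leq_trans le_Li; apply: (allP szW _ cW).
Qed.

End Covers.

(** * Computable conditions for the greedy argument *)

Section Certificates.
Import GRing.Theory.
Local Open Scope ring_scope.
Local Open Scope classical_set_scope.

(** [behead] drops the zero word, and a nonzero last digit makes the length of the list [v] the true
    size of its polynomial. *)
Definition code_check xi eta (G : seq word) (v : word) : bool :=
  [&& all (fun c => 6 <= twt (shear xi eta c))%N (behead (wspan G)),
      all (fun g => size g < size v)%N G, ~~ teq T0 (last T0 v) &
      all (fun c => 6 <= twt (shear xi eta (wadd v c)))%N (wspan G)].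

(* The differences [z - c] are written [z + c + c]. *)
Definition witness_check xi eta (G : seq word) (v z : word) : bool :=
  has (fun u => let n := wval u in
    BinNat.N.ltb (wval z) n &&
    all (fun c => BinNat.N.leb n (wval c) ||
                  (6 <= twt (shear xi eta (wadd z (wadd c c))))%N) (wspan (v :: G)))
  [seq wadd v g | g <- G].

Lemma size_lspan_le n (G : seq {poly 'F_3}) :
  (forall g, g \in G -> size g <= n)%N -> forall c, c \in lspan G -> (size c <= n)%N.
Proof.
elim: G => [|g G IHG] szG c; first by rewrite inE => /eqP ->; rewrite size_poly0.
move=> /mem_lspan_cons[t cG]; rewrite -(subrK (t *: g) c).
rewrite (leq_trans (size_polyD _ _)) // geq_max; apply/andP; split.
  by apply: IHG cG => h hG; rewrite szG // inE hG orbT.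
by rewrite (leq_trans (size_scale_leq _ _)) // szG ?mem_head.
Qed.

Lemma mem_lspan_pol G c : c \in wspan G -> pol c \in lspan (map pol G).
Proof. by move=> cG; rewrite -pol_span map_f. Qed.

Lemma lspan_polP G (c : {poly 'F_3}) :
  c \in lspan (map pol G) -> exists2 s, s \in wspan G & pol s = c.
Proof. by rewrite -pol_span => /mapP[s sG ->]; exists s. Qed.

Lemma size_pol_last v : ~~ teq T0 (last T0 v) -> size (pol v) = size v.
Proof.
move=> v0; apply/eqP; rewrite eqn_leq size_pol /=; case: v v0 => // a v v0.
rewrite ltnNge; apply: contra v0 => /leq_sizeP/(_ _ (leqnn _)).
by rewrite coef_pol (last_nth T0) => /eqP; rewrite -[_ == _]negbK t2F_eq0 negbK.
Qed.

Variables (F : nat -> {poly 'F_3}) (xi eta M : nat) (G : seq word) (v z : word).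
Hypothesis lincombI : injective (lincomb F).
Hypothesis lincombS : forall x, exists a, lincomb F a = x.
(** Weights in [F] are compared with those of [F(xi, eta)] on words of at most [M] digits; thus one
    certificate serves many bases. *)
Hypothesis isoM : forall a : {poly 'F_3}, (size a <= M)%N ->
  wt (lincomb F a) = wt (sh xi eta a).
Hypothesis codeGv : code_check xi eta G v.
Hypothesis le_vM : (size v <= M)%N.
Hypothesis cover_v : forall y, (nu y < nu (pol v))%N -> exists c,
  [/\ c \in wspan G, (nu (pol c) <= nu y)%N & (wt (sh xi eta (y - pol c)%R) < 6)%N].

Let size_v : size (pol v) = size v.
Proof. by case/and4P: codeGv => _ _ /size_pol_last. Qed.

Let size_G c : c \in lspan (map pol G) -> (size c < size (pol v))%N.
Proof.
case/and4P: codeGv => _ /allP szG v0 _.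
have v_gt0 : (0 < size v)%N by case: (v) v0.
rewrite size_v -(prednK v_gt0) ltnS; apply: size_lspan_le => _ /mapP[g gG ->].
by rewrite -ltnS (prednK v_gt0) (leq_ltn_trans (size_pol g)) ?szG.
Qed.

Let wt_lincomb s : (size (pol s) <= M)%N -> wt (lincomb F (pol s)) = twt (shear xi eta s).
Proof. by move=> /isoM ->; rewrite -pol_shear wt_pol. Qed.

Let uniqG : uniq (lspan (map pol G)).
Proof.
case/and4P: codeGv => /allP dG _ _ _; apply: lspan_uniq.
rewrite -pol_span behead_map; apply/mapP => -[s /dG + s0].
by rewrite -wt_pol pol_shear -s0 linear0 wt0.
Qed.

Let dist_G c : c \in lspan (map pol G) -> c <> 0 -> (6 <= wt (lincomb F c))%N.
Proof.
case/and4P: codeGv => /allP dG _ _ _ cG; have := size_G cG; move: cG.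
rewrite {1}lspan_behead inE => /orP[/eqP -> //|].
rewrite -pol_span behead_map => /mapP[s sG ->] /ltnW lt_sv _.
by rewrite wt_lincomb ?dG // (leq_trans lt_sv) // size_v.
Qed.

Let dist_v c : c \in lspan (map pol G) -> (6 <= wt (lincomb F (pol v - c)%R))%N.
Proof.
case/and4P: codeGv => _ _ _ /allP dv /lspanN cG.
have := size_G cG; case/lspan_polP: cG => s sG <- /ltnW lt_sv.
rewrite -polD wt_lincomb ?dv // polD (leq_trans (size_polyD _ _)) //.
by rewrite geq_max (leq_trans lt_sv) size_v le_vM.
Qed.

Let cover_lincomb y : (nu y < nu (pol v))%N -> exists c,
  [/\ c \in lspan (map pol G), (nu c <= nu y)%N & (wt (lincomb F (y - c)%R) < 6)%N].
Proof.
move=> lt_yv; have [c [cG le_cy wt_c]] := cover_v lt_yv; exists (pol c).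
split=> //; first exact: mem_lspan_pol.
rewrite isoM // (leq_trans (size_polyD _ _)) // size_polyN geq_max.
apply/andP; split; apply: leq_trans le_vM; rewrite -size_v.
  exact/nu_le_size/ltnW.
exact/ltnW/size_G/mem_lspan_pol.
Qed.

Lemma Lex_certified :
  Lex F 6 (size G) = [set lincomb F (pol c) | c in [set` wspan G]].
Proof.
rewrite -(size_map pol) (Lex_lspan lincombI lincombS _ uniqG dist_G cover_lincomb size_G dist_v) //.
apply/seteqP; split=> _ [c /= cG <-].
  by have [s sG <-] := lspan_polP cG; exists s.
by exists (pol c) => //=; apply: mem_lspan_pol.
Qed.

Hypothesis witness_z : witness_check xi eta G v z.
Hypothesis le_zv : (size z <= size v)%N.

Lemma maxlin_certified : maxlin F 6 = Some (size G).
Proof.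
have /hasP[_ /mapP[g gG ->]] := witness_z; set u := wadd v g.
move=> /andP[/BinNat.N.ltb_lt lt_zu /allP far_z].
rewrite -(size_map pol).
have uG : pol u \in lspan (pol v :: map pol G).
  by rewrite polD lspanD ?sub_lspan ?inE ?eqxx // map_f ?orbT.
apply: (maxlin_lspan lincombI lincombS _ uniqG dist_G cover_lincomb size_G dist_v _ uG (z := pol z)) => //.
  by rewrite !wvalE; lia.
move=> c cvG lt_cu.
have sz_c : (size c <= size v)%N.
  move: cvG; apply: size_lspan_le => h; rewrite inE => /orP[/eqP ->|]; first by rewrite size_pol.
  by move=> /sub_lspan/size_G/ltnW; rewrite size_v.
have [s sG eq_s] : exists2 s, s \in wspan (v :: G) & pol s = c.
  exact: (@lspan_polP (v :: G)).
have eq_zs : pol z - c = pol (wadd z (wadd s s)).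
  rewrite !polD eq_s -[c in c + c]scale1r -scalerDl -scaleN1r.
  by congr (_ + _ *: _); apply/eqP.
have /orP[/BinNat.N.leb_le le_us|] := far_z _ sG.
  by move: lt_cu; rewrite -eq_s !wvalE; lia.
rewrite eq_zs wt_lincomb // -eq_zs (leq_trans (size_polyD _ _)) // size_polyN.
by rewrite geq_max !(leq_trans _ le_vM) // (leq_trans (size_pol z)).
Qed.

End Certificates.

(** * The two kinds of bases and their weights *)

Section Bases.
Import GRing.Theory.
Local Open Scope ring_scope.
Implicit Types a : {poly 'F_3}.

Lemma lincomb_std a : lincomb (std_basis 3) a = a.
Proof. by rewrite /lincomb -poly_def coefK. Qed.

Lemma lincomb_mod xi eta a : lincomb (mod_basis 3 xi eta) a = sh xi eta a.
Proof.
rewrite /sh -[X in X + _]lincomb_std.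
have le_a : (size a <= maxn (size a) xi.+1)%N by rewrite leq_maxl.
have lt_xi : (xi < maxn (size a) xi.+1)%N by rewrite leq_maxr.
rewrite !(lincombE _ le_a) (bigD1 (Ordinal lt_xi)) //=.
rewrite [X in _ = X + _](bigD1 (Ordinal lt_xi)) //=.
rewrite /mod_basis /std_basis eqxx scalerDr -!addrA; congr (_ + _).
rewrite addrC; congr (_ + _); apply: eq_bigr => i neq_i.
by rewrite ifF //; apply: contraNF neq_i => /eqP i_xi; apply/eqP/val_inj.
Qed.

Lemma shK xi eta : xi <> eta -> cancel (sh xi eta) (fun a : {poly 'F_3} => a - a`_xi *: 'X^eta).
Proof.
by move=> /eqP neq a; rewrite /sh coefD coefZ coefXn (negPf neq) mulr0 addr0 addrK.
Qed.

Lemma shVK xi eta : xi <> eta -> cancel (fun a : {poly 'F_3} => a - a`_xi *: 'X^eta) (sh xi eta).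
Proof.
by move=> /eqP neq a; rewrite /sh coefB coefZ coefXn (negPf neq) mulr0 subr0 subrK.
Qed.

Lemma sh_id xi eta a : (size a <= xi)%N -> sh xi eta a = a.
Proof. by move=> le_a; rewrite /sh nth_default // scale0r addr0. Qed.

(** The coordinate [eta] lies above [a] and merely repeats the digit at [xi], so the weight is the
    same for all such [eta]. *)
Lemma wt_sh_high xi eta a : (size a <= eta)%N -> wt (sh xi eta a) = (wt a + (a`_xi != 0)%R)%N.
Proof.
move=> le_a; have le_sh : (size (sh xi eta a) <= eta.+1)%N.
  rewrite (leq_trans (size_polyD _ _)) // geq_max (leq_trans le_a) //=.
  by rewrite (leq_trans (size_scale_leq _ _)) // size_polyXn.
rewrite (wtE le_sh) (wtE le_a) big_ord_recr /=; congr (_ + _)%N.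
  by apply: eq_bigr => i _; rewrite coefD coefZ coefXn ltn_eqF // mulr0 addr0.
by rewrite coefD coefZ coefXn eqxx mulr1 [a`_eta]nth_default ?add0r.
Qed.

End Bases.

(** * Covering below [v] when [v] has 15 digits *)

Section LongCode.
Import GRing.Theory.
Local Open Scope ring_scope.

Fixpoint echelon (G : seq word) : bool :=
  if G is g :: G' then
    [&& ~~ teq T0 (last T0 g), all (fun h => size h < size g)%N G' & echelon G']
  else true.

Definition pivots (G : seq word) : seq nat := [seq (size g).-1 | g <- G].

(** Gaussian elimination at the top digits: the generators get strictly shorter, so later
    corrections do not disturb a pivot already cleared. *)
Lemma pivot_reduction G (y : {poly 'F_3}) : echelon G ->
  exists2 c, c \in lspan (map pol G) & forall i, i \in pivots G -> (y - c)`_i = 0.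
Proof.
elim: G y => [|g G IHG] y /=; first by exists 0; rewrite ?inE.
case/and3P=> g0 /allP szG /IHG {}IHG; set p := (size g).-1.
have p_gt0 : (0 < size g)%N by case: (g) g0.
have gp : (pol g)`_p != 0 by rewrite coef_pol nth_last t2F_eq0.
have [c cG yc] := IHG (y - (y`_p / (pol g)`_p) *: pol g).
exists ((y`_p / (pol g)`_p) *: pol g + c).
  by apply/mem_lspan_cons; exists (y`_p / (pol g)`_p); rewrite addrC addKr.
move=> i; rewrite opprD addrA inE => /orP[/eqP ->|/yc //].
rewrite !coefB coefZ divfK // subrr sub0r nth_default ?oppr0 //.
apply: size_lspan_le cG => _ /mapP[h hG ->]; rewrite -ltnS (prednK p_gt0).
exact: leq_ltn_trans (size_pol h) (szG h hG).
Qed.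

Lemma nu_pol_cat s t : nu (pol (s ++ t)) = (nu (pol s) + 3 ^ size s * nu (pol t))%N.
Proof.
by rewrite !nu_pol; elim: s => [|a s IHs] /=; rewrite ?mul1n // IHs expnS; lia.
Qed.

Lemma nu_pol_lt s : (nu (pol s) < 3 ^ size s)%N.
Proof.
by rewrite nu_pol; elim: s => //= a s IHs; rewrite expnS; case: a => /=; lia.
Qed.

Lemma pol_cat s t : pol (s ++ t) = pol s + pol (nseq (size s) T0 ++ t).
Proof.
apply/polyP => i; rewrite coefD !coef_pol !nth_cat size_nseq nth_nseq.
by case: ltnP => lti; rewrite ?addr0 // [nth _ s _]nth_default ?add0r.
Qed.

(* The word [v] consists of 12 digits followed by three digits 1. Words [y < v]
   with at most 12 digits are covered within distance 5; if [y] has one or two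
   nonzero digits at the top, its lower part is covered within distance 3, in
   whatever order, and it suffices to check this modulo the code; if it has three,
   then its lower part precedes that of [v] and is within distance 2 of 0. *)
Definition long_certificate xi (G : seq word) (v : word) : bool :=
  [&& drop 12 v == [:: T1; T1; T1], size v == 15%N, all (fun g => size g <= 12)%N G, echelon G,
      covers xi 9 12 (iota 0 12) [:: 4; 4; 4; 4; 3; 3; 2; 2; 1]
        [seq (c, 5, false) | c <- wspan G],
      covers xi 9 12 [seq i <- iota 0 12 | i \notin pivots G] [::]
        [seq (c, 3, true) | c <- wspan G] &
      covers xi 9 12 (iota 0 12) [::] [:: (take 12 v, 12, false); ([::], 2, false)]]%N.

Lemma size_wspan_le n (G : seq word) :
  all (fun g => size g <= n)%N G -> forall c, c \in wspan G -> (size c <= n)%N.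
Proof.
have size_wadd s t : (size (wadd s t) <= maxn (size s) (size t))%N.
  by elim: s t => [|a s IHs] [|b t] //=; rewrite ?maxn0 // maxnSS ltnS.
elim: G => [|g G IHG] /=; first by move=> _ c; rewrite inE => /eqP ->.
case/andP=> sz_g /IHG {}IHG c; rewrite !mem_cat => /or3P[/IHG //||] /mapP[e /IHG sz_e ->].
  by rewrite (leq_trans (size_wadd _ _)) // geq_max sz_g.
rewrite (leq_trans (size_wadd _ _)) // geq_max sz_e andbT.
by rewrite (leq_trans (size_wadd _ _)) // maxnn.
Qed.

Lemma long_coverP xi G v y : (xi < 12)%N -> long_certificate xi G v ->
  (nu y < nu (pol v))%N -> exists c,
  [/\ c \in wspan G, (nu (pol c) <= nu y)%N & (wt (sh xi 9 (y - pol c)%R) < 6)%N].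
Proof.
move=> lt_xi /and5P[/eqP v111 /eqP sz_v szG echG /and3P[cov5 cov3 cov2]] lt_yv.
have szC := size_wspan_le szG.
have sz_cov (b : nat) (st : bool) : all (fun c => size c.1.1 <= 12)%N [seq (c, b, st) | c <- wspan G].
  by rewrite all_map; apply/allP => c /szC.
have free12 (x : {poly 'F_3}) : (size x <= 12)%N -> forall i, i \notin iota 0 12 -> x`_i = 0.
  move=> sz_x i; rewrite mem_iota -leqNgt => le_i.
  by rewrite nth_default // (leq_trans sz_x).
have le_y15 : (size y <= 15)%N.
  by rewrite -sz_v (leq_trans (nu_le_size (ltnW lt_yv))) ?size_pol.
have [s sz_s def_y] := word_of_poly le_y15.
set lo := take 12 s; set hi := drop 12 s.
have sz_lo : size lo = 12%N by rewrite size_takel ?sz_s.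
have eq_y : y = pol lo + pol (nseq 12 T0 ++ hi).
  by rewrite -def_y -{1}(cat_take_drop 12 s) pol_cat sz_lo.
have sz_plo : (size (pol lo) <= 12)%N by rewrite -sz_lo size_pol.
(* The digits from index 12 on lie beyond [xi], so the shear fixes them. *)
have wt_hi : wt (sh xi 9 (pol (nseq 12 T0 ++ hi))) = twt hi.
  rewrite /sh coef_pol nth_cat size_nseq lt_xi nth_nseq lt_xi scale0r addr0.
  by rewrite wt_pol /twt count_cat count_nseq.
have wt_y c : (wt (sh xi 9 (y - pol c)%R) <= wt (sh xi 9 (pol lo - pol c)%R) + twt hi)%N.
  by rewrite -wt_hi eq_y addrAC (linearD (sh xi 9)) wtD.
have [hi0|hi_gt0] := posnP (twt hi).
  have [[[_ b] st] /mapP[c cG [-> -> ->]] /= /andP[le_c wt_c]] :=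
    coversP (isT : 9 < 12)%N (sz_cov 5%N false) cov5 sz_plo (free12 _ sz_plo).
  have eq_lo : y = pol lo.
    have : pol (nseq 12 T0 ++ hi) = 0.
      by apply/eqP; rewrite -wt_eq0 wt_pol /twt count_cat count_nseq -/(twt hi) hi0.
    by rewrite eq_y => ->; rewrite addr0.
  by exists c; rewrite eq_lo ltnS; split.
have size_hi : (12 < size y)%N.
  rewrite ltnNge; apply: contraL hi_gt0 => le_y; rewrite -eqn0Ngt -wt_hi.
  have -> : pol (nseq 12 T0 ++ hi) = 0; last by rewrite linear0 wt0.
  apply/polyP => i; rewrite coef_pol nth_cat size_nseq nth_nseq coef0.
  case: ltnP => // le_i; rewrite nth_drop subnKC // -coef_pol def_y.
  by rewrite nth_default // (leq_trans le_y).
(* With at most two nonzero upper digits the distances add up to at most 3 + 2, and the codeword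
   precedes [y] because it has at most 12 digits while [y] has more. *)
have [hi3|hi2] := ltnP 2 (twt hi); last first.
  have [c0 /lspan_polP[s0 s0G <-] red] := pivot_reduction (pol lo) echG.
  have sz_r : (size (pol lo - pol s0)%R <= 12)%N.
    rewrite (leq_trans (size_polyD _ _)) // size_polyN geq_max sz_plo.
    by rewrite (leq_trans (size_pol _)) ?szC.
  have free_r i : i \notin [seq i <- iota 0 12 | i \notin pivots G] -> (pol lo - pol s0)`_i = 0.
    by rewrite mem_filter negb_and negbK => /orP[/red|/(free12 _ sz_r)].
  have [[[_ b] st] /mapP[c cG [-> -> ->]] /= wt_c] :=
    coversP (isT : 9 < 12)%N (sz_cov 3%N true) cov3 sz_r free_r.
  have [e eG eq_e] : exists2 e, e \in wspan G & pol e = pol s0 + pol c.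
    by apply: lspan_polP; apply: lspanD; apply: mem_lspan_pol.
  exists e; split=> //; last first.
    rewrite (leq_ltn_trans (wt_y e)) // eq_e opprD addrA.
    by rewrite (leq_ltn_trans (leq_add wt_c hi2)).
  by apply/ltnW/size_lt_nu; rewrite (leq_ltn_trans (size_pol e)) // (leq_ltn_trans (szC e eG)).
have eq_nu_y : nu y = (nu (pol lo) + 3 ^ 12 * nu (pol hi))%N.
  by rewrite -def_y -{1}(cat_take_drop 12 s) nu_pol_cat sz_lo.
have sz_v12 : size (take 12 v) = 12%N by rewrite size_takel ?sz_v.
(* Three nonzero upper digits are each at least 1, and [y < v] forces them to be 111 as in [v]; so
   the lower parts decide the comparison. *)
have lt_lo : (nu (pol lo) < nu (pol (take 12 v)))%N.
  move: lt_yv hi3; rewrite eq_nu_y -{1}(cat_take_drop 12 v) nu_pol_cat sz_v12 v111.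
  have := nu_pol_lt (take 12 v); rewrite sz_v12.
  have : size hi = 3%N by rewrite size_drop sz_s.
  move: (3 ^ 12)%N (nu (pol lo)) (nu (pol (take 12 v))) (hi) => X m n.
  case=> [|a [|b [|c []]]] //= _; rewrite !nu_pol /=.
  by case: a; case: b; case: c => //=; lia.
have sz_cov2 : all (fun c => size c.1.1 <= 12)%N
    [:: (take 12 v, 12%N, false); ([::], 2%N, false)] by rewrite /= sz_v12.
have [c] := coversP (isT : 9 < 12)%N sz_cov2 cov2 sz_plo (free12 _ sz_plo).
(* The entry for the lower part of [v] fits only words that are not below it; what remains is the
   zero codeword, at distance at most 2 + 3. *)
rewrite !inE => /orP[] /eqP -> /=; first by rewrite leqNgt lt_lo.
move=> /andP[_ wt_lo]; exists [::]; split.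
- by elim: (G) => [|g G' IH] //=; rewrite mem_cat IH.
- by rewrite /nu /pol /= polyseq0.
rewrite (leq_ltn_trans (wt_y _)) //.
have hi_le3 : (twt hi <= 3)%N by rewrite (leq_trans (count_size _ _)) // size_drop sz_s.
by rewrite (leq_ltn_trans (leq_add wt_lo hi_le3)).
Qed.

End LongCode.

(** * Recognising the ternary Golay code *)

Section Golay.
Import GRing.Theory.
Local Open Scope ring_scope.
Local Open Scope classical_set_scope.

Lemma lspan_ind (V : lmodType 'F_3) (P : V -> Prop) (G : seq V) :
  P 0 -> (forall t g x, g \in G -> P x -> P (t *: g + x)) ->
  forall x, x \in lspan G -> P x.
Proof.
move=> P0; elim: G => [|g G IHG] PG x; first by rewrite inE => /eqP ->.
move=> /mem_lspan_cons[t xG]; rewrite -(subrK (t *: g) x) addrC.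
apply: (PG); rewrite ?mem_head //; apply: IHG xG => s h y hG; apply: PG.
by rewrite inE hG orbT.
Qed.

Lemma mem_lspan_span (V : vectType 'F_3) (G : seq V) x :
  (x \in <<G>>%VS) = (x \in lspan G).
Proof.
apply/idP/idP => [|]; last first.
  apply: (lspan_ind (P := fun y => is_true (y \in <<G>>%VS))) => [|t g y gG yG].
    exact: mem0v.
  by rewrite memvD // memvZ // memv_span.
elim: G x => [|g G IHG] x; first by rewrite span_nil memv0 inE.
rewrite span_cons => /memv_addP[_ /vlineP[t ->] [y /IHG yG ->]].
by apply/mem_lspan_cons; exists t; rewrite addrC addKr.
Qed.

Lemma lspan_free (V : vectType 'F_3) (G : seq V) : 0 \notin behead (lspan G) -> free G.
Proof.
elim: G => [|g G IHG]; first by rewrite nil_free.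
rewrite [X in behead X]/= [X in X ++ _]lspan_behead /= !mem_cat !negb_or.
case/and3P=> /IHG freeG gG0 _; rewrite free_cons freeG andbT mem_lspan_span.
by apply: contraNN gG0 => /lspanN gG; apply/mapP; exists (- g); rewrite ?subrr.
Qed.

Definition row12 (x : {poly 'F_3}) : 'rV['F_3]_12 := \row_j x`_j.

Lemma row12_is_linear : linear row12.
Proof. by move=> a x y; apply/rowP => j; rewrite !mxE coefD coefZ. Qed.
HB.instance Definition _ :=
  GRing.isLinear.Build 'F_3 {poly 'F_3} 'rV['F_3]_12 _ row12 row12_is_linear.

Lemma row_hdist12 (x y : {poly 'F_3}) : (size (x - y)%R <= 12)%N ->
  row_hdist (row12 x) (row12 y) = wt (x - y).
Proof.
move=> le_xy; rewrite (wtE le_xy) /row_hdist -sum1_card big_mkcond /=.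
by apply: eq_bigr => i _; rewrite inE !mxE coefB subr_eq0; case: (_ != _).
Qed.

Lemma res_coords_word12 (S : seq word) :
  all (fun s => size s <= 12)%N S ->
  all (fun i => has (fun s => ~~ teq T0 (nth T0 s i)) S) (iota 0 12) ->
  res_coords [set pol s | s in [set` S]] = iota 0 12.
Proof.
move=> /allP szS /allP nzS.
have AE : [set i | exists2 x, [set pol s | s in [set` S]] x & x`_i != 0] = [set` iota 0 12].
  apply/seteqP; split=> i.
    move=> [_ [s /szS sz_s <-]] si; suff: i \in iota 0 12 by [].
    rewrite mem_iota; move: si; apply: contraTT; rewrite -leqNgt => le_i.
    by rewrite coef_pol nth_default ?eqxx // (leq_trans sz_s).
  move=> i12; have /nzS/hasP[s sS si] : i \in iota 0 12 by [].
  by exists (pol s); [exists s|rewrite coef_pol t2F_eq0].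
rewrite /res_coords AE; apply: (sorted_eq leq_trans anti_leq).
- exact: (sort_sorted leq_total).
- exact: iota_sorted.
rewrite perm_sort; apply: uniq_perm; rewrite ?fset_uniq ?iota_uniq // => i.
by rewrite in_fset_set ?mem_setE //; apply: finite_seq.
Qed.

Lemma Res_golay (L : set {poly 'F_3}) : res_coords L = iota 0 12 ->
  is_ternary_golay [set row12 x | x in L] -> is_ternary_golay (Res L).
Proof.
move=> eq_r gol; rewrite /Res.
(* The row length depends on the list of coordinates, so the list is generalised before it is
   replaced. *)
suff: forall r, r = iota 0 12 ->
    is_ternary_golay ([set \row_j x`_(nth 0%N r j) | x in L] : set 'rV_(size r)) by apply.
move=> _ ->.
have <- // : [set row12 x | x in L] = [set \row_j x`_(nth 0%N (iota 0 12) j) | x in L].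
by apply: eq_imagel => x _; apply/rowP => j; rewrite !mxE nth_iota.
Qed.

Definition golay_words : seq word :=
  [:: [:: T1; T0; T0; T0; T0; T0; T0; T1; T1; T1; T1; T1];
      [:: T0; T1; T0; T0; T0; T0; T1; T0; T1; T2; T2; T1];
      [:: T0; T0; T1; T0; T0; T0; T1; T1; T0; T1; T2; T2];
      [:: T0; T0; T0; T1; T0; T0; T1; T2; T1; T0; T1; T2];
      [:: T0; T0; T0; T0; T1; T0; T1; T2; T2; T1; T0; T1];
      [:: T0; T0; T0; T0; T0; T1; T1; T1; T2; T2; T1; T0]].

Lemma row_golay (i : 'I_6) : row i golay_matrix = row12 (pol (nth [::] golay_words i)).
Proof.
apply/rowP => j; rewrite !mxE coef_pol.
case: splitP => k jk; rewrite !mxE jk {j jk}; apply/val_inj.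
  by case: i => [[|[|[|[|[|[|//]]]]]] ?]; case: k => [[|[|[|[|[|[|//]]]]]] ?].
by case: i => [[|[|[|[|[|[|//]]]]]] ?]; case: k => [[|[|[|[|[|[|//]]]]]] ?].
Qed.

Lemma golay_lspan : [set u *m golay_matrix | u in [set: 'rV['F_3]_6]] =
  [set` lspan (map row12 (map pol golay_words))].
Proof.
have memG (i : 'I_6) : row i golay_matrix \in map row12 (map pol golay_words).
  by rewrite row_golay !map_f // mem_nth.
apply/seteqP; split=> x.
  move=> [u _ <-].
  suff : u *m golay_matrix \in lspan (map row12 (map pol golay_words)) by [].
  rewrite mulmx_sum_row; elim/big_ind: _ => [|y z|i _].
  - exact: lspan0.
  - exact: lspanD.
  by rewrite -[_ *: _]addr0 lspan_linear ?lspan0 // sub_lspan.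
move=> xG; apply: (lspan_ind (P := fun x => exists2 u : 'rV_6, True & u *m golay_matrix = x) _ _ xG).
  by exists 0; rewrite ?mul0mx.
move=> t _ y /mapP[_ /mapP[w wG ->] ->] [u _ <-] {x xG y}.
have lt_w : (index w golay_words < 6)%N by rewrite -[6%N]/(size golay_words) index_mem.
exists (t *: delta_mx 0 (Ordinal lt_w) + u) => //.
by rewrite mulmxDl -scalemxAl -rowE row_golay /= nth_index.
Qed.

Definition tmul a b := match a with T0 => T0 | T1 => b | T2 => tadd b b end.

Lemma t2FM a b : t2F (tmul a b) = t2F a * t2F b.
Proof. by case: a; case: b; apply/eqP. Qed.

Definition mono (sl : seq nat) (ul s : word) : word :=
  mkseq (fun j => tmul (nth T0 ul j) (nth T0 s (nth 0%N sl j))) 12.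

(** The generators of each code are tested for membership in the other, so equality of the spans
    becomes a finite check. *)
Definition golay_check (sl : seq nat) (ul : word) (G : seq word) : bool :=
  [&& perm_eq sl (iota 0 12), size ul == 12%N, all (fun a => ~~ teq T0 a) ul,
      all (fun g => mono sl ul g \in wspan golay_words) G &
      all (fun h => h \in wspan (map (mono sl ul) G)) golay_words].

Lemma monomially_equivalent_golay (G : seq word) (sl : seq nat) (ul : word) :
  golay_check sl ul G ->
  monomially_equivalent [set` lspan (map row12 (map pol G))]
    [set u *m golay_matrix | u in [set: 'rV['F_3]_6]].
Proof.
case/and5P=> perm_sl /eqP sz_ul /allP ul0 /allP G_gol /allP gol_G.
have sz_sl : size sl = 12%N by rewrite (perm_size perm_sl) size_iota.
have lt_sl (j : 'I_12) : (nth 0 sl j < 12)%N.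
  have : nth 0%N sl j \in iota 0 12 by rewrite -(perm_mem perm_sl) mem_nth ?sz_sl.
  by rewrite mem_iota.
pose s (j : 'I_12) := Ordinal (lt_sl j); pose u (j : 'I_12) := t2F (nth T0 ul j).
exists s, u; split.
- apply: injF_bij => i j /(congr1 val)/eqP /=.
  by rewrite nth_uniq ?sz_sl ?(perm_uniq perm_sl) ?iota_uniq // => /eqP/val_inj.
- by move=> j; rewrite t2F_eq0 ul0 // mem_nth ?sz_ul.
pose T (x : 'rV['F_3]_12) : 'rV['F_3]_12 := \row_j (u j * x 0 (s j)).
have T_linear : linear T.
  by move=> a x y; apply/rowP => j; rewrite !mxE mulrDr mulrCA.
pose T' : {linear 'rV['F_3]_12 -> 'rV['F_3]_12} :=
  HB.pack T (GRing.isLinear.Build _ _ _ _ T T_linear).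
have T_mono w : T (row12 (pol w)) = row12 (pol (mono sl ul w)).
  by apply/rowP => j; rewrite !mxE !coef_pol nth_mkseq // t2FM.
have eqTG : map T (map row12 (map pol G)) = map row12 (map pol (map (mono sl ul) G)).
  by rewrite -!map_comp; apply: eq_map => w /=; rewrite T_mono.
have mem_row H w : w \in wspan H -> row12 (pol w) \in lspan (map row12 (map pol H)).
  by move=> wH; rewrite lspan_map map_f // mem_lspan_pol.
have eqT : lspan (map row12 (map pol golay_words)) =i map T (lspan (map row12 (map pol G))).
  rewrite -(lspan_map T') -[map T' _]/(map T _) eqTG => x; apply/idP/idP; apply: lspan_sub => {x} x.
    by move=> /mapP[_ /mapP[w /gol_G wG ->] ->]; apply: mem_row.
  by move=> /mapP[_ /mapP[_ /mapP[w /G_gol wG ->] ->] ->]; apply: mem_row.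
rewrite golay_lspan; apply/seteqP; split=> x.
  move=> xG; have : x \in lspan (map row12 (map pol golay_words)) by [].
  by rewrite eqT => /mapP[y yG ->]; exists y.
move=> [y yG <-]; suff : T y \in lspan (map row12 (map pol golay_words)) by [].
by rewrite eqT map_f.
Qed.

(** Distances in a linear code are weights of codewords. The weight bound also excludes vanishing
    nontrivial combinations, which gives the dimension. *)
Lemma nkd_lspan (G : seq word) : size G = 6%N ->
  all (fun g => size g <= 12)%N G ->
  all (fun c => 6 <= twt c)%N (behead (wspan G)) ->
  has (fun c => twt c == 6)%N (wspan G) ->
  is_nkd_code [set` lspan (map row12 (map pol G))] 12 6 6.
Proof.
move=> szG /size_wspan_le sz12 /allP wtG /hasP[c6 c6G /eqP wt_c6].
have sz_pol c : c \in lspan (map pol G) -> (size c <= 12)%N.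
  by move=> /lspan_polP[s /sz12 sz_s <-]; apply: leq_trans (size_pol s) sz_s.
have dist x y : x \in lspan (map pol G) -> y \in lspan (map pol G) ->
    x != y -> (6 <= row_hdist (row12 x) (row12 y))%N.
  move=> xG yG neq; have xyG := lspanB xG yG; rewrite row_hdist12 ?sz_pol //.
  move: xyG; rewrite lspan_behead inE subr_eq0 (negPf neq) -pol_span behead_map.
  by move=> /mapP[s /wtG + ->]; rewrite wt_pol.
split=> //.
- exists <<map row12 (map pol G)>>%VS.
    by apply/seteqP; split=> x /=; rewrite mem_lspan_span.
  have /eqP -> : free (map row12 (map pol G)); last by rewrite !size_map.
  apply: lspan_free; rewrite lspan_map behead_map; apply/mapP => -[x xG x0].
  have x_in : x \in lspan (map pol G) by rewrite lspan_behead inE xG orbT.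
  have neq : x != 0.
    move: xG; rewrite -pol_span behead_map => /mapP[s /wtG + ->].
    by rewrite -wt_pol; apply: contraTneq => ->; rewrite wt0.
  have := dist _ _ x_in (lspan0 _) neq.
  by rewrite -x0 linear0 /row_hdist eq_card0 // => i; rewrite inE eqxx.
- move=> x y; rewrite /= lspan_map => /mapP[x' xG ->] /mapP[y' yG ->] neq.
  by rewrite dist //; apply/eqP => xy; apply: neq; rewrite xy.
have c6in : pol c6 \in lspan (map pol G) by apply: mem_lspan_pol.
have wt6 : row_hdist (row12 (pol c6)) (row12 0) = 6%N.
  by rewrite row_hdist12 subr0 ?wt_pol // sz_pol.
exists (row12 (pol c6)), (row12 0); split=> //=.
- by rewrite lspan_map map_f.
- by rewrite lspan_map map_f // lspan0.
by move=> eq0; move: wt6; rewrite eq0 /row_hdist eq_card0 // => i; rewrite inE eqxx.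
Qed.

End Golay.

Notation string := String.string.

(** * Tables of codes and witnesses *)

Section Data.
Local Open Scope string_scope.

(* In these tables a string lists the words [z], [v] and [G] of the header, with
   the generators in [G] sorted downwards; they come from running the greedy
   construction. The codes of [data2] belong to [F(xi, eta)] with [eta <= 8]. *)
Definition data2 : seq (seq string) :=
  [:: [:: "";
       "101102022 101010211 11001102 111101";
       "101102202 101010121 11001012 111011";
       "101102202 101011021 11000112 110111";
       "110012120 101011021 11000112 101111";
       "110102120 101101021 11000112 11111";
       "111002120 101101021 10100112 11111";
       "111002120 110101021 1100112 11111";
       "111002120 110101021 1100112 11111"];
      [:: "101102022 101010211 11001120 111110";
       "";
       "101102220 101010112 11001021 111011";
       "101102220 101011012 11000121 110111";
       "110012102 101011012 11000121 101111";
       "110102102 101101012 11000121 11111";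
       "111002102 101101012 10100121 11111";
       "111002102 110101012 1100121 11111";
       "111002102 110101012 1100121 11111"];
      [:: "101102021 101010210 11001121 111110";
       "101102012 101010201 11001112 111101";
       "";
       "101102021 101011212 11000122 110111";
       "110012110 101011212 11000122 101111";
       "110102110 101101212 11000122 11111";
       "111002110 101101212 10100122 11111";
       "111002110 110101212 1100122 11111";
       "111002110 110101212 1100122 11111"];
      [:: "101102022 101010212 11001121 111110";
       "101102001 101010212 11001112 111101";
       "101102121 101010212 11001022 111011";
       "";
       "110012121 101011201 11001022 101111";
       "110102121 101101201 11001022 11111";
       "111002121 101101201 10101022 11111";
       "111002121 110101201 1101022 11111";
       "111002121 110101201 1101022 11111"];
      [:: "101102021 101010211 11001122 111110";
       "101102021 101010202 11001122 111101";
       "101102021 101010112 11001122 111011";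
       "101100221 101011012 11001122 110111";
       "";
       "110102021 101100212 11001122 11111";
       "111002021 101100212 10101122 11111";
       "111002021 110100212 1101122 11111";
       "111002021 110100212 1101122 11111"];
      [:: "101102020 101010212 11001122 111110";
       "101102011 101010212 11001122 111101";
       "101102221 101010212 11001122 111011";
       "101101021 101010212 11001122 110111";
       "110012021 101010212 11001122 101111";
       "";
       "111002021 101010212 10011122 101111";
       "111002021 110010212 1011122 101111";
       "111002021 110010212 1011122 101111"];
      [:: "101102020 101010211 11001121 111111";
       "101102011 101010202 11001112 111111";
       "101102221 101010112 11001022 111111";
       "101102221 101011012 11000122 111111";
       "110001212 101002201 11000122 111111";
       "110001212 101002201 11000122 111111";
       "";
       "110102021 110010212 1001122 111111";
       "110102021 110010212 1001122 111111"];
      [:: "101102021 101010212 11001121 111111";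
       "101102021 101010212 11001112 111111";
       "101102021 101010212 11001022 111111";
       "101102021 101010212 11000122 111111";
       "110002201 101001212 11000122 111111";
       "110002201 101001212 11000122 111111";
       "101102021 101010212 10001122 111111";
       "";
       "101102021 101010212 10001122 111111"];
      [:: "101102020 101010211 11001122 111111";
       "101102011 101010202 11001122 111111";
       "101102221 101010112 11001122 111111";
       "101102221 101011012 11001122 111111";
       "110002021 101000212 11001122 111111";
       "110002021 101000212 11001122 111111";
       "100102021 100010212 11001122 111111";
       "100102021 100010212 11001122 111111";
       ""]].

(* The same for [eta >= 10]. *)
Definition data3 : seq string :=
  [:: "1011001110 1010100011 110001012 1100112 11111";
      "1011001101 1010100011 110001021 1100121 11111";
      "1011001100 1010100220 110001201 1100122 11111";
      "1010111000 1010100112 110001202 1101022 11111";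
      "1010111002 1010100111 110001212 1101122 11111";
      "1010111002 1010010111 110001212 1011122 101111";
      "1010102201 1010010122 110001212 1001122 111111";
      "1001102201 1001010122 101001212 10001122 111111";
      "1001102021 1001010212 100001212 11001122 111111"].

Definition data_std : string := "101102021 101010212 11001122 111111".

(* The same for [eta = 9]. *)
Definition data6 : seq string :=
  [:: "111000000011100 111000000000011 100010201001 10010200202 1010102210 110001012 1100112 11111";
      "111000000011100 111000000000011 100010201010 10010200220 1010102201 110001021 1100121 11111";
      "111000000011010 111000000000101 100010201011 10010200101 1010102110 110001201 1100122 11111";
      "111000000011000 111000000000111 100010202200 10010201010 1010102112 110001202 1101022 11111";
      "111000000011000 111000000000111 100010202022 10010201101 1010100221 110001212 1101122 11111";
      "111000000101000 111000000000111 100010022022 10010021101 1010010221 110001212 1011122 101111";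
      "111000000111000 111000000000111 100010022011 10010021120 1010010221 110001212 1001122 111111";
      "111000000111000 111000000000111 100001022011 10001021120 1001010221 101001212 10001122 111111";
      "111000000111000 111000000000111 100001022101 10001021210 1001010221 100001212 11001122 111111"].

(* The permutations of the coordinates and the factors, listed downwards, that map
   the codes of [data6] to the code generated by [golay_matrix]. *)
Definition data_golay : seq (seq nat * string) :=
  [:: ([:: 0; 1; 2; 3; 4; 11; 10; 6; 7; 8; 5; 9], "221211112211");
      ([:: 0; 1; 2; 3; 4; 7; 5; 8; 11; 6; 10; 9], "221111212211");
      ([:: 0; 1; 2; 3; 4; 5; 11; 10; 6; 7; 8; 9], "222211212211");
      ([:: 0; 1; 2; 3; 4; 10; 5; 8; 7; 11; 6; 9], "221111212211");
      ([:: 0; 1; 2; 3; 4; 8; 10; 5; 11; 6; 7; 9], "212221212211");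
      ([:: 0; 1; 2; 3; 4; 11; 8; 9; 7; 5; 10; 6], "111111121111");
      ([:: 0; 1; 2; 3; 4; 7; 10; 6; 11; 9; 8; 5], "212221212211");
      ([:: 0; 1; 2; 3; 4; 6; 10; 7; 11; 9; 8; 5], "212221212211");
      ([:: 0; 1; 2; 3; 4; 9; 11; 7; 10; 6; 8; 5], "212122212211")].

End Data.

(* Space-separated words, each with its top digit first. *)
Fixpoint parse (s : string) (w : word) : seq word :=
  match s with
  | String.EmptyString => [:: w]
  | String.String c s' =>
    match Ascii.nat_of_ascii c with
    | 32 => w :: parse s' [::]
    | 48 => parse s' (T0 :: w)
    | 49 => parse s' (T1 :: w)
    | _ => parse s' (T2 :: w)
    end
  end.

Definition words (s : string) : seq word := parse s [::].

(** * Evaluation of the certificates, and the cases of the theorem *)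

Section Tables.
Import GRing.Theory.
Local Open Scope ring_scope.

(* The entry for [v] has a budget that is never exhausted: it covers all [y >= v]. *)
Definition certificate k xi eta L M (s : string) : bool :=
  if words s is z :: v :: G then
    [&& code_check xi eta G v, witness_check xi eta G v z,
        [&& size G == k, size v == M & size z == M] &
        covers xi eta L (iota 0 M) [::] ((v, L, false) :: [seq (c, 5, false) | c <- wspan G])]%N
  else false.

Lemma certificateP F k xi eta L M s :
  injective (lincomb F) -> (forall x, exists a, lincomb F a = x) ->
  (forall a : {poly 'F_3}, (size a <= M)%N -> wt (lincomb F a) = wt (sh xi eta a)) ->
  (eta < L)%N -> (M <= L)%N -> certificate k xi eta L M s -> maxlin F 6 = Some k.
Proof.
move=> Finj Fsurj isoF lt_eta le_ML; rewrite /certificate.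
case: (words s) => [|z [|v G]] // /and4P[codeGv wit /and3P[/eqP <- /eqP sz_v /eqP sz_z] cov].
apply: (maxlin_certified (xi := xi) (eta := eta) (M := M) (v := v) (z := z)); rewrite ?sz_v ?sz_z //.
move=> y lt_yv.
have le_yM : (size y <= M)%N by rewrite -sz_v (leq_trans (nu_le_size (ltnW lt_yv))) ?size_pol.
have szG : all (fun c => size c.1.1 <= L)%N
    ((v, L, false) :: [seq (c, 5%N, false) | c <- wspan G]).
  rewrite /= sz_v le_ML all_map; apply/allP => c cG /=.
  apply: (size_wspan_le _ cG); apply/allP => g gG.
  case/and4P: codeGv => _ /allP/(_ g gG)/ltnW le_gv _ _.
  by rewrite (leq_trans le_gv) ?sz_v.
have y0 i : i \notin iota 0 M -> y`_i = 0.
  by rewrite mem_iota -leqNgt => le_i; rewrite nth_default // (leq_trans le_yM).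
have [c] := coversP lt_eta szG cov (leq_trans le_yM le_ML) y0.
rewrite inE => /orP[/eqP -> /=|/mapP[{}c cG -> /=]]; first by rewrite leqNgt lt_yv.
by case/andP=> le_c wt_c; exists c.
Qed.

(** The standard basis is treated as [F(9, 0)] on words of 9 digits, where digit 9 vanishes. The
    length 10 lets the search meet index 9, so that only the guess 0 survives. *)
Lemma certificate_std : certificate 2 9 0 10 9 data_std.
Proof. by vm_compute. Qed.

Lemma certificate_low :
  all (fun xi => all (fun eta => (xi == eta) ||
    certificate 2 xi eta 9 9 (nth String.EmptyString (nth [::] data2 xi) eta)) (iota 0 9)) (iota 0 9).
Proof. by vm_compute. Qed.

(** The index 10 stands for every [eta >= 10], by [wt_sh_high]. *)
Lemma certificate_high :
  all (fun xi => certificate 3 xi 10 11 10 (nth String.EmptyString data3 xi)) (iota 0 9).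
Proof. by vm_compute. Qed.

Definition certificate6 xi (s : string) : bool :=
  if words s is z :: v :: G then
    [&& code_check xi 9 G v, witness_check xi 9 G v z, (size G == 6) && (size z == 15) &
        long_certificate xi G v]%N
  else false.

Lemma certificate6_all :
  all (fun xi => certificate6 xi (nth String.EmptyString data6 xi)) (iota 0 9).
Proof. by vm_compute. Qed.

(** [drop 2] leaves the generators, sheared into standard coordinates. The second test shows that
    none of the 12 coordinates vanishes on the code, so [Res] keeps them all. *)
Definition golay_certificate xi (s : string) (m : seq nat * string) : bool :=
  let H := map (shear xi 9) (drop 2 (words s)) in
  [&& all (fun g => size g <= 12)%N H, 
      all (fun i => has (fun c => ~~ teq T0 (nth T0 c i)) (wspan H)) (iota 0 12),
      all (fun c => 6 <= twt c)%N (behead (wspan H)), has (fun c => twt c == 6)%N (wspan H) &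
      golay_check m.1 (head [::] (words m.2)) H].

Lemma golay_certificate_all :
  all (fun xi => golay_certificate xi (nth String.EmptyString data6 xi)
    (nth ([::], String.EmptyString) data_golay xi)) (iota 0 9).
Proof. by vm_compute. Qed.

Section Mod.
Variables xi eta : nat.
Hypothesis neq : xi <> eta.

Lemma lincomb_mod_inj : injective (lincomb (mod_basis 3 xi eta)).
Proof.
by move=> a b; rewrite !lincomb_mod => /(can_inj (shK neq)).
Qed.

Lemma lincomb_mod_surj x : exists a, lincomb (mod_basis 3 xi eta) a = x.
Proof. by exists (x - x`_xi *: 'X^eta); rewrite lincomb_mod (shVK neq). Qed.

End Mod.

Lemma maxlin_std : maxlin (std_basis 3) 6 = Some 2.
Proof.
apply: certificateP certificate_std => // [a b|x|a le_a].
- by rewrite !lincomb_std.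
- by exists x; rewrite lincomb_std.
by rewrite lincomb_std sh_id.
Qed.

Lemma maxlin_large xi eta : xi <> eta -> (9 <= xi)%N ->
  maxlin (mod_basis 3 xi eta) 6 = Some 2.
Proof.
move=> neq le_xi; apply: certificateP certificate_std => // [||a le_a].
- exact: lincomb_mod_inj.
- exact: lincomb_mod_surj.
(* Both [xi] and the index 9 of the certificate lie beyond the 9 digits of [a], so both shears are
   trivial. *)
by rewrite lincomb_mod !sh_id // (leq_trans le_a).
Qed.

Lemma maxlin_low xi eta : xi <> eta -> (xi < 9)%N -> (eta < 9)%N ->
  maxlin (mod_basis 3 xi eta) 6 = Some 2.
Proof.
move=> neq lt_xi lt_eta.
have xi9 : xi \in iota 0 9 by rewrite mem_iota.
have eta9 : eta \in iota 0 9 by rewrite mem_iota.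
have /allP/(_ eta eta9)/orP[/eqP //|] := allP certificate_low xi xi9.
apply: certificateP => // [||a le_a]; last by rewrite lincomb_mod.
  exact: lincomb_mod_inj.
exact: lincomb_mod_surj.
Qed.

Lemma maxlin_high xi eta : (xi < 9)%N -> (10 <= eta)%N ->
  maxlin (mod_basis 3 xi eta) 6 = Some 3.
Proof.
move=> lt_xi le_eta; have neq : xi <> eta by lia.
have xi9 : xi \in iota 0 9 by rewrite mem_iota.
apply: certificateP (allP certificate_high xi xi9) => // [||a le_a].
- exact: lincomb_mod_inj.
- exact: lincomb_mod_surj.
by rewrite lincomb_mod !wt_sh_high // (leq_trans le_a).
Qed.

Lemma golay_case xi : (xi < 9)%N ->
  maxlin (mod_basis 3 xi 9) 6 = Some 6 /\ is_ternary_golay (Res (Lex (mod_basis 3 xi 9) 6 6)).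
Proof.
move=> lt_xi; have neq : xi <> 9%N by lia.
have xi9 : xi \in iota 0 9 by rewrite mem_iota.
have := allP golay_certificate_all xi xi9; have := allP certificate6_all xi xi9.
rewrite /certificate6 /golay_certificate.
move: (nth _ data6 xi) (nth _ data_golay xi) => s [sl ul].
case: (words s) => [|z [|v G]] // /and4P[codeGv wit /andP[/eqP szG /eqP sz_z] long].
rewrite [drop _ _]/= drop0; set H := map (shear xi 9) G.
case/and5P=> szH nzH wtH wt6H golH.
have sz_v : size v = 15%N by case/and5P: long => _ /eqP.
have iso (a : {poly 'F_3}) : (size a <= 15)%N -> wt (lincomb (mod_basis 3 xi 9) a) = wt (sh xi 9 a).
  by rewrite lincomb_mod.
have cov y := @long_coverP xi G v y (leq_trans lt_xi (isT : 9 <= 12)%N) long.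
have le_v : (size v <= 15)%N by rewrite sz_v.
split.
  rewrite -[X in _ = Some X]szG.
  apply: (maxlin_certified (lincomb_mod_inj neq) (lincomb_mod_surj neq) iso codeGv le_v cov wit).
  by rewrite sz_v sz_z.
have eqL : Lex (mod_basis 3 xi 9) 6 6 = [set pol c | c in [set` wspan H]]%classic.
  rewrite -[X in Lex _ _ X]szG.
  rewrite (Lex_certified (lincomb_mod_inj neq) (lincomb_mod_surj neq) iso codeGv le_v cov).
  have eqH : map pol H = map (sh xi 9) (map pol G).
    by rewrite -!map_comp; apply: eq_map => g /=; rewrite pol_shear.
  apply/seteqP; split=> _ [c /= cG <-].
    have : sh xi 9 (pol c) \in lspan (map pol H).
      by rewrite eqH lspan_map map_f // mem_lspan_pol.
    by rewrite lincomb_mod => /lspan_polP[e eH <-]; exists e.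
  have : pol c \in lspan (map pol H) by rewrite mem_lspan_pol.
  rewrite eqH lspan_map => /mapP[x /lspan_polP[e eG <-] ->].
  by exists e => //; rewrite lincomb_mod.
have eqR : [set row12 x | x in Lex (mod_basis 3 xi 9) 6 6]%classic =
    [set` lspan (map row12 (map pol H))]%classic.
  rewrite eqL; apply/seteqP; split=> x /=.
    by move=> [_ [c cH <-] <-]; rewrite lspan_map map_f // mem_lspan_pol.
  by rewrite lspan_map -pol_span => /mapP[_ /mapP[c cH ->] ->]; exists (pol c) => //; exists c.
apply: Res_golay.
  by rewrite eqL res_coords_word12 //; apply/allP/(size_wspan_le szH).
rewrite eqR; split; last exact: monomially_equivalent_golay golH.
by apply: nkd_lspan => //; rewrite size_map.
Qed.

End Tables.

Theorem theorem1p6 :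
  forall F : nat -> {poly 'F_3}, basis_family 3 F ->
    maxlin F 6 =
      (if `[< exists xi : nat, (xi <= 8)%N /\ F = mod_basis 3 xi 9 >]
       then Some 6
       else if `[< exists xi eta : nat,
                     [/\ (xi <= 8)%N, (10 <= eta)%N & F = mod_basis 3 xi eta] >]
       then Some 3
       else Some 2)
    /\
    (forall xi : nat, (xi <= 8)%N -> F = mod_basis 3 xi 9 ->
       is_ternary_golay (Res (Lex F 6 6))).
Proof.
move=> F famF; split; last first.
  by move=> xi le_xi ->; have [] := golay_case le_xi.
case: asboolP => [[xi [le_xi ->]]|not9]; first by have [] := golay_case le_xi.
case: asboolP => [[xi [eta [le_xi le_eta ->]]]|not10]; first exact: maxlin_high.
case: famF => [->|[xi [eta [neq defF]]]]; first exact: maxlin_std.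
rewrite defF; have [le_xi|lt_xi] := leqP 9 xi; first exact: maxlin_large.
(* The values [eta >= 10] and [eta = 9] are excluded by the two conditions that failed. *)
apply: maxlin_low => //; case: (ltngtP eta 9) => // [lt_eta|eta9].
  by case: not10; exists xi, eta.
by case: not9; exists xi; split=> //; rewrite defF eta9.
Qed.
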